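(* Let $K$ be a field, $E$ a finite directed graph and $L(E)$ its Leavitt path algebra over $K$. The general linear groupoid $\mathbf G(L(E))$ (with respect to the vertex set $E^0$) is generated by the sets $$\operatorname{E}_\sigma(L(E)),\quad \operatorname{F}_{\sigma\times\tau}(L(E)),\quad \operatorname{P}_{\sigma\times\tau}(K)\qquad(\sigma,\tau\in\mathcal S).$$
   Context: A directed graph is $E=(E^0,E^1,r,s)$ with sets $E^0$ (vertices), $E^1$ (edges) and maps $r,s:E^1\to E^0$; finite means $E^0,E^1$ finite. A vertex $v$ is regular if $0<|s^{-1}(v)|<\infty$ and a sink if $s^{-1}(v)=\emptyset$. The Leavitt path algebra $L=L(E)$ is the $K$-algebra presented by generators $v,e,e^*$ ($v\in E^0$, $e\in E^1$) and relations: (i) $uv=\delta_{uv}u$; (ii) $s(e)e=e=er(e)$, $r(e)e^*=e^*=e^*s(e)$; (iii) $e^*f=\delta_{ef}r(e)$; (iv) $\sum_{e\in s^{-1}(v)}ee^*=v$ for regular $v$. For finite $E$ it is unital with $1=\sum_{v\in E^0}v$, so $E^0$ is a complete set of orthogonal idempotents. Write the regular vertices as $v_1,\dots,v_p$, the sinks as $v_{p+1},\dots,v_q$, and $s^{-1}(v_i)=\{f_{i,1},\dots,f_{i,m_i}\}$. Put $\mathcal S=\bigcup_{n\ge1}(E^0)^n$. For $\sigma\in(E^0)^m$, $\tau\in(E^0)^n$, $\mathbb M_{\sigma\times\tau}(L)$ is the set of $m\times n$ matrices $A$ with $A_{ij}\in\sigma_iL\tau_j$; $I_\sigma=\operatorname{diag}(\sigma_1,\dots,\sigma_m)$;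 $\operatorname{GL}_{\sigma\times\tau}(L)$ is the set of $A\in\mathbb M_{\sigma\times\tau}(L)$ for which there is $B\in\mathbb M_{\tau\times\sigma}(L)$ with $AB=I_\sigma$, $BA=I_\tau$; $\operatorname{GL}_\sigma(L)=\operatorname{GL}_{\sigma\times\sigma}(L)$. The groupoid $\mathbf G(L)$ has object set $\mathcal S$, $\operatorname{Hom}(\sigma,\tau)=\operatorname{GL}_{\tau\times\sigma}(L)$ and composition given by matrix multiplication. The subgroupoid generated by a set $S$ of morphisms has as objects all sources and targets of elements of $S$ and as morphisms all finite compositions of morphisms from $S\cup S^{-1}$. $\operatorname{E}_\sigma(L)$ is the subgroup of $\operatorname{GL}_\sigma(L)$ generated by all elementary matrices $E_{ij}(x)=I_\sigma+e_{ij}(x)$, $i\ne j$, $x\in\sigma_iL\sigma_j$, where $e_{ij}(x)$ has entry $x$ at $(i,j)$ and $0$ elsewhere. $\operatorname{F}_{\sigma\times\tau}(L)$ is the set of all block-diagonal matrices $A=\operatorname{diag}(A_1,\dots,A_\ell)\in\operatorname{GL}_{\sigma\times\tau}(L)$ such that each block $A_j$ is either (i) the $1\times1$ matrix $(v)$ with $v\in E^0$, or (ii) the row $(f_{i,1},\dots,f_{i,m_i})$ with $1\le i\le p$, or (iii) the column $(f_{i,1},\dots,f_{i,m_i})^*$ with entries $f_{i,1}^*,\dots,f_{i,m_i}^*$ (top to bottom), $1\le i\le p$. For $\sigma,\tau\in(E^0)^n$, $\operatorname{P}_{\sigma\times\tau}(K)$ is the set of generalised permutation matrices, i.e. of matrices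 $P\in\operatorname{GL}_{\sigma\times\tau}(L)$ such that for some permutation $\pi$ of $\{1,\dots,n\}$ with $\sigma_i=\tau_{\pi(i)}$ for all $i$ and some $k_1,\dots,k_n\in K^\times$ one has $P_{ij}=\delta_{j,\pi(i)}k_i\sigma_i$ for all $i,j$. ($\operatorname{P}_{\sigma\times\tau}(K)$ is empty if there is no such $\pi$, in particular if $\sigma$ and $\tau$ have different lengths.) *)

(* Defs.v *)
From HB Require Import structures.
From mathcomp Require Import all_boot all_order all_algebra.
From mathcomp Require Import perm generic_quotient boolp.

Set Implicit Arguments.
Unset Strict Implicit.
Unset Printing Implicit Defensive.

Import GRing.Theory.
Local Open Scope ring_scope.
Local Open Scope quotient_scope.

Record digraph := Digraph {
  vertex : finType;
  edge : finType;
  src : edge -> vertex;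
  tgt : edge -> vertex
}.

Definition out_edges (E : digraph) (v : vertex E) : {set edge E} :=
  [set e | src e == v].

Definition regular (E : digraph) (v : vertex E) : bool :=
  (0 < #|out_edges v|)%N.

(* f v lists s^-1(v) without repetition, in an arbitrary order. *)
Definition out_enumeration (E : digraph) (f : vertex E -> seq (edge E)) : Prop :=
  forall v, perm_eq (f v) (enum (out_edges v)).

(* The Leavitt path algebra is the set of nonunital K-algebra terms in the
   generators v, e, e^*, modulo the least congruence that contains the algebra
   axioms and the relations (i)-(iv).  There is no term for 1: that the sum of
   the vertices is a unit is proved below. *)
Section LeavittPathAlgebra.
Variables (K : fieldType) (E : digraph).

Inductive lpa_term : Type :=
| TVertex (v : vertex E)
| TEdge (e : edge E)
| TGhost (e : edge E)
| TZero
| TAdd (x y : lpa_term)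
| TOpp (x : lpa_term)
| TScale (k : K) (x : lpa_term)
| TMul (x y : lpa_term).

Inductive lpa_rel : lpa_term -> lpa_term -> Prop :=
| lpa_refl x : lpa_rel x x
| lpa_sym x y : lpa_rel x y -> lpa_rel y x
| lpa_trans x y z : lpa_rel x y -> lpa_rel y z -> lpa_rel x z
| lpa_congD x x' y y' :
    lpa_rel x x' -> lpa_rel y y' -> lpa_rel (TAdd x y) (TAdd x' y')
| lpa_congN x x' : lpa_rel x x' -> lpa_rel (TOpp x) (TOpp x')
| lpa_congZ k x x' : lpa_rel x x' -> lpa_rel (TScale k x) (TScale k x')
| lpa_congM x x' y y' :
    lpa_rel x x' -> lpa_rel y y' -> lpa_rel (TMul x y) (TMul x' y')
| lpa_addA x y z : lpa_rel (TAdd x (TAdd y z)) (TAdd (TAdd x y) z)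
| lpa_addC x y : lpa_rel (TAdd x y) (TAdd y x)
| lpa_add0 x : lpa_rel (TAdd TZero x) x
| lpa_addN x : lpa_rel (TAdd (TOpp x) x) TZero
| lpa_scaleA a b x : lpa_rel (TScale a (TScale b x)) (TScale (a * b) x)
| lpa_scale1 x : lpa_rel (TScale 1 x) x
| lpa_scaleDr a x y :
    lpa_rel (TScale a (TAdd x y)) (TAdd (TScale a x) (TScale a y))
| lpa_scaleDl a b x :
    lpa_rel (TScale (a + b) x) (TAdd (TScale a x) (TScale b x))
| lpa_mulA x y z : lpa_rel (TMul x (TMul y z)) (TMul (TMul x y) z)
| lpa_mulDl x y z : lpa_rel (TMul (TAdd x y) z) (TAdd (TMul x z) (TMul y z))
| lpa_mulDr x y z : lpa_rel (TMul x (TAdd y z)) (TAdd (TMul x y) (TMul x z))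
| lpa_scaleMl a x y : lpa_rel (TMul (TScale a x) y) (TScale a (TMul x y))
| lpa_scaleMr a x y : lpa_rel (TMul x (TScale a y)) (TScale a (TMul x y))
| lpa_vv u v :
    lpa_rel (TMul (TVertex u) (TVertex v)) (if u == v then TVertex u else TZero)
| lpa_se e : lpa_rel (TMul (TVertex (src e)) (TEdge e)) (TEdge e)
| lpa_er e : lpa_rel (TMul (TEdge e) (TVertex (tgt e))) (TEdge e)
| lpa_rg e : lpa_rel (TMul (TVertex (tgt e)) (TGhost e)) (TGhost e)
| lpa_gs e : lpa_rel (TMul (TGhost e) (TVertex (src e))) (TGhost e)
| lpa_ge e f :
    lpa_rel (TMul (TGhost e) (TEdge f))
            (if e == f then TVertex (tgt e) else TZero)
| lpa_eg v : regular v ->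
    lpa_rel (\big[TAdd/TZero]_(e <- enum (out_edges v))
               TMul (TEdge e) (TGhost e))
            (TVertex v).

HB.instance Definition _ := gen_eqMixin lpa_term.
HB.instance Definition _ := gen_choiceMixin lpa_term.

Definition lpa_relb : rel lpa_term := fun x y => `[< lpa_rel x y >].

Lemma lpa_relb_refl : reflexive lpa_relb.
Proof. by move=> x; apply/asboolP; apply: lpa_refl. Qed.

Lemma lpa_relb_sym : symmetric lpa_relb.
Proof. by move=> x y; apply/asboolP/asboolP; apply: lpa_sym. Qed.

Lemma lpa_relb_trans : transitive lpa_relb.
Proof.
by move=> y x z /asboolP xy /asboolP yz; apply/asboolP; apply: lpa_trans yz.
Qed.

Canonical lpa_equiv := EquivRel lpa_relb lpa_relb_refl lpa_relb_sym lpa_relb_trans.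

Definition lpa : Type := {eq_quot lpa_equiv}.
HB.instance Definition _ := Choice.on lpa.
HB.instance Definition _ := Quotient.on lpa.

Lemma lpaP x y : lpa_rel x y <-> \pi_lpa x = \pi_lpa y.
Proof.
split=> [xy | /eqmodP /asboolP //].
by apply/eqmodP; apply/asboolP.
Qed.

Definition lpa_zero : lpa := \pi_lpa TZero.
Definition lpa_add (x y : lpa) : lpa := \pi_lpa (TAdd (repr x) (repr y)).
Definition lpa_opp (x : lpa) : lpa := \pi_lpa (TOpp (repr x)).
Definition lpa_scale (k : K) (x : lpa) : lpa := \pi_lpa (TScale k (repr x)).
Definition lpa_mul (x y : lpa) : lpa := \pi_lpa (TMul (repr x) (repr y)).

Lemma lpa_reprP x : lpa_rel (repr (\pi_lpa x)) x.
Proof. by apply/lpaP; rewrite reprK. Qed.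

Lemma pi_add x y : lpa_add (\pi_lpa x) (\pi_lpa y) = \pi_lpa (TAdd x y).
Proof. by apply/lpaP; apply: lpa_congD; apply: lpa_reprP. Qed.

Lemma pi_opp x : lpa_opp (\pi_lpa x) = \pi_lpa (TOpp x).
Proof. by apply/lpaP; apply: lpa_congN; apply: lpa_reprP. Qed.

Lemma pi_scale k x : lpa_scale k (\pi_lpa x) = \pi_lpa (TScale k x).
Proof. by apply/lpaP; apply: lpa_congZ; apply: lpa_reprP. Qed.

Lemma pi_mul x y : lpa_mul (\pi_lpa x) (\pi_lpa y) = \pi_lpa (TMul x y).
Proof. by apply/lpaP; apply: lpa_congM; apply: lpa_reprP. Qed.

Lemma lpa_ind (P : lpa -> Prop) : (forall t, P (\pi_lpa t)) -> forall x, P x.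
Proof. by move=> Ppi x; rewrite -[x]reprK. Qed.

Lemma lpa_addrA : associative lpa_add.
Proof.
elim/lpa_ind=> x; elim/lpa_ind=> y; elim/lpa_ind=> z.
by rewrite !pi_add; apply/lpaP; apply lpa_addA.
Qed.

Lemma lpa_addrC : commutative lpa_add.
Proof.
elim/lpa_ind=> x; elim/lpa_ind=> y.
by rewrite !pi_add; apply/lpaP; apply lpa_addC.
Qed.

Lemma lpa_add0r : left_id lpa_zero lpa_add.
Proof. by elim/lpa_ind=> x; rewrite pi_add; apply/lpaP; apply lpa_add0. Qed.

Lemma lpa_addNr : left_inverse lpa_zero lpa_opp lpa_add.
Proof.
by elim/lpa_ind=> x; rewrite pi_opp pi_add; apply/lpaP; apply lpa_addN.
Qed.

HB.instance Definition _ :=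
  GRing.isZmodule.Build lpa lpa_addrA lpa_addrC lpa_add0r lpa_addNr.

Lemma lpa_scalerA a b v : lpa_scale a (lpa_scale b v) = lpa_scale (a * b) v.
Proof.
elim/lpa_ind: v => v.
by rewrite !pi_scale; apply/lpaP; apply lpa_scaleA.
Qed.

Lemma lpa_scale1r : left_id 1 lpa_scale.
Proof. by elim/lpa_ind=> x; rewrite pi_scale; apply/lpaP; apply lpa_scale1. Qed.

Lemma lpa_scalerDr : right_distributive lpa_scale +%R.
Proof.
move=> a; elim/lpa_ind=> x; elim/lpa_ind=> y.
by rewrite [_ + _]pi_add !pi_scale [RHS]pi_add; apply/lpaP; apply lpa_scaleDr.
Qed.

Lemma lpa_scalerDl v : {morph lpa_scale^~ v : a b / a + b}.
Proof.
elim/lpa_ind: v => v a b.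
by rewrite !pi_scale [RHS]pi_add; apply/lpaP; apply lpa_scaleDl.
Qed.

HB.instance Definition _ := GRing.Zmodule_isLmodule.Build K lpa
  lpa_scalerA lpa_scale1r lpa_scalerDr lpa_scalerDl.

Definition lpa_vertex (v : vertex E) : lpa := \pi_lpa (TVertex v).
Definition lpa_edge (e : edge E) : lpa := \pi_lpa (TEdge e).
Definition lpa_ghost (e : edge E) : lpa := \pi_lpa (TGhost e).

Definition lpa_one : lpa := \sum_v lpa_vertex v.

Lemma lpa_mulrA : associative lpa_mul.
Proof.
elim/lpa_ind=> x; elim/lpa_ind=> y; elim/lpa_ind=> z.
by rewrite !pi_mul; apply/lpaP; apply lpa_mulA.
Qed.

Lemma lpa_mulrDl : left_distributive lpa_mul +%R.
Proof.
elim/lpa_ind=> x; elim/lpa_ind=> y; elim/lpa_ind=> z.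
by rewrite [_ + _]pi_add !pi_mul [RHS]pi_add; apply/lpaP; apply lpa_mulDl.
Qed.

Lemma lpa_mulrDr : right_distributive lpa_mul +%R.
Proof.
elim/lpa_ind=> x; elim/lpa_ind=> y; elim/lpa_ind=> z.
by rewrite [_ + _]pi_add !pi_mul [RHS]pi_add; apply/lpaP; apply lpa_mulDr.
Qed.

Lemma lpa_mul0r x : lpa_mul 0 x = 0.
Proof. by apply: (addrI (lpa_mul 0 x)); rewrite -lpa_mulrDl !addr0. Qed.

Lemma lpa_mulr0 x : lpa_mul x 0 = 0.
Proof. by apply: (addrI (lpa_mul x 0)); rewrite -lpa_mulrDr !addr0. Qed.

Lemma lpa_mulNr x y : lpa_mul (- x) y = - lpa_mul x y.
Proof.
by apply: (addrI (lpa_mul x y)); rewrite -lpa_mulrDl !subrr lpa_mul0r.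
Qed.

Lemma lpa_mulrN x y : lpa_mul x (- y) = - lpa_mul x y.
Proof.
by apply: (addrI (lpa_mul x y)); rewrite -lpa_mulrDr !subrr lpa_mulr0.
Qed.

Lemma lpa_scaleMl_op k x y : lpa_mul (k *: x) y = k *: lpa_mul x y.
Proof.
elim/lpa_ind: x => x; elim/lpa_ind: y => y.
rewrite [k *: _]pi_scale !pi_mul [RHS]pi_scale.
by apply/lpaP; apply lpa_scaleMl.
Qed.

Lemma lpa_scaleMr_op k x y : lpa_mul x (k *: y) = k *: lpa_mul x y.
Proof.
elim/lpa_ind: x => x; elim/lpa_ind: y => y.
rewrite [k *: _]pi_scale !pi_mul [RHS]pi_scale.
by apply/lpaP; apply lpa_scaleMr.
Qed.

Lemma lpa_mul_vv u v : lpa_mul (lpa_vertex u) (lpa_vertex v) =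
  if u == v then lpa_vertex u else 0.
Proof.
rewrite pi_mul; have /lpaP-> := lpa_vv u v.
by case: (u == v).
Qed.

Lemma lpa_oneMl x v : lpa_mul (lpa_vertex v) x = x -> lpa_mul lpa_one x = x.
Proof.
move=> vx; rewrite -{1}vx lpa_mulrA.
suff -> : lpa_mul lpa_one (lpa_vertex v) = lpa_vertex v by [].
rewrite (big_morph _ (fun a b => lpa_mulrDl a b _) (lpa_mul0r _)).
rewrite (bigD1 v) //= lpa_mul_vv eqxx big1 ?addr0 // => u /negPf uv.
by rewrite lpa_mul_vv uv.
Qed.

Lemma lpa_oneMr x v : lpa_mul x (lpa_vertex v) = x -> lpa_mul x lpa_one = x.
Proof.
move=> xv; rewrite -{1}xv -lpa_mulrA.
suff -> : lpa_mul (lpa_vertex v) lpa_one = lpa_vertex v by [].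
rewrite (big_morph _ (lpa_mulrDr _) (lpa_mulr0 _)).
rewrite (bigD1 v) //= lpa_mul_vv eqxx big1 ?addr0 // => u /negPf uv.
by rewrite lpa_mul_vv eq_sym uv.
Qed.

Lemma lpa_mul1r : left_id lpa_one lpa_mul.
Proof.
elim/lpa_ind; elim=> [v|e|e||x IHx y IHy|x IHx|k x IHx|x IHx y IHy].
- by apply: (@lpa_oneMl _ v); rewrite lpa_mul_vv eqxx.
- by apply: (@lpa_oneMl _ (src e)); rewrite pi_mul; apply/lpaP/lpa_se.
- by apply: (@lpa_oneMl _ (tgt e)); rewrite pi_mul; apply/lpaP/lpa_rg.
- exact: lpa_mulr0.
- by rewrite -pi_add lpa_mulrDr IHx IHy.
- by rewrite -pi_opp lpa_mulrN IHx.
- by rewrite -pi_scale lpa_scaleMr_op IHx.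
- by rewrite -pi_mul lpa_mulrA IHx.
Qed.

Lemma lpa_mulr1 : right_id lpa_one lpa_mul.
Proof.
elim/lpa_ind; elim=> [v|e|e||x IHx y IHy|x IHx|k x IHx|x IHx y IHy].
- by apply: (@lpa_oneMr _ v); rewrite lpa_mul_vv eqxx.
- by apply: (@lpa_oneMr _ (tgt e)); rewrite pi_mul; apply/lpaP/lpa_er.
- by apply: (@lpa_oneMr _ (src e)); rewrite pi_mul; apply/lpaP/lpa_gs.
- exact: lpa_mul0r.
- by rewrite -pi_add lpa_mulrDl IHx IHy.
- by rewrite -pi_opp lpa_mulNr IHx.
- by rewrite -pi_scale lpa_scaleMl_op IHx.
- by rewrite -pi_mul -lpa_mulrA IHy.
Qed.

(* Only a pzRingType: L(E) is zero when E has no vertex. *)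
HB.instance Definition _ := GRing.Zmodule_isPzRing.Build lpa
  lpa_mulrA lpa_mul1r lpa_mulr1 lpa_mulrDl lpa_mulrDr.

Lemma lpa_vertexM u v :
  lpa_vertex u * lpa_vertex v = if u == v then lpa_vertex u else 0.
Proof. exact: lpa_mul_vv. Qed.

Lemma lpa_vertexK v : lpa_vertex v * lpa_vertex v = lpa_vertex v.
Proof. by rewrite lpa_vertexM eqxx. Qed.

Lemma lpa_scalerAl (k : K) (x y : lpa) : k *: (x * y) = (k *: x) * y.
Proof. by rewrite [RHS]lpa_scaleMl_op. Qed.

Lemma lpa_scalerAr (k : K) (x y : lpa) : k *: (x * y) = x * (k *: y).
Proof. by rewrite [RHS]lpa_scaleMr_op. Qed.

End LeavittPathAlgebra.

(* wlen is the length minus one: the empty word is excluded. *)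
Record word (V : Type) := Word { wlen : nat; wval : wlen.+1.-tuple V }.

Section CornerMatrices.
Variables (R : pzRingType) (V : Type) (e : V -> R).
Hypothesis eK : forall v, e v * e v = e v.

Definition in_corner m n (s : m.-tuple V) (t : n.-tuple V) (A : 'M[R]_(m, n)) :=
  forall i j, exists x, A i j = e (tnth s i) * x * e (tnth t j).

Definition corner_id m (s : m.-tuple V) : 'M[R]_m :=
  diag_mx (\row_i e (tnth s i)).

Definition corner_inverse m n (s : m.-tuple V) (t : n.-tuple V)
    (A : 'M[R]_(m, n)) (B : 'M[R]_(n, m)) : Prop :=
  [/\ in_corner t s B, A *m B = corner_id s & B *m A = corner_id t].

Definition GLmx m n (s : m.-tuple V) (t : n.-tuple V) (A : 'M[R]_(m, n)) : Prop :=
  in_corner s t A /\ exists B, corner_inverse s t A B.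

Definition elementary_mx m (s : m.-tuple V) (i j : 'I_m) (x : R) : 'M[R]_m :=
  corner_id s + x *: delta_mx i j.

Inductive Emx m (s : m.-tuple V) : 'M[R]_m -> Prop :=
| Emx_elementary (i j : 'I_m) (y : R) : i != j ->
    Emx s (elementary_mx s i j (e (tnth s i) * y * e (tnth s j)))
| Emx_id : Emx s (corner_id s)
| Emx_mul A B : Emx s A -> Emx s B -> Emx s (A *m B)
| Emx_inv A B : Emx s A -> corner_inverse s s A B -> Emx s B.

Lemma in_corner_id m (s : m.-tuple V) : in_corner s s (corner_id s).
Proof.
move=> i j; rewrite !mxE; case: eqP => [->|_].
  by exists (e (tnth s j)); rewrite mulr1n !eK.
by exists 0; rewrite mulr0n mulr0 mul0r.
Qed.

Lemma corner_mulmx1 m n (s : m.-tuple V) (t : n.-tuple V) A :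
  in_corner s t A -> A *m corner_id t = A.
Proof.
move=> sAt; apply/matrixP=> i j; rewrite mul_mx_diag !mxE.
by have [x ->] := sAt i j; rewrite -!mulrA eK.
Qed.

Lemma corner_mul1mx m n (s : m.-tuple V) (t : n.-tuple V) A :
  in_corner s t A -> corner_id s *m A = A.
Proof.
move=> sAt; apply/matrixP=> i j; rewrite mul_diag_mx !mxE.
by have [x ->] := sAt i j; rewrite !mulrA eK.
Qed.

Lemma in_corner_mul m n p (s : m.-tuple V) (t : n.-tuple V) (u : p.-tuple V) A B :
  in_corner s t A -> in_corner t u B -> in_corner s u (A *m B).
Proof.
move=> sAt tBu i j; exists ((A *m B) i j); rewrite !mxE mulr_sumr mulr_suml.
apply: eq_bigr => k _.
have [x ->] := sAt i k; have [y ->] := tBu k j.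
by rewrite -!mulrA eK !mulrA eK.
Qed.

Lemma GLmx_id m (s : m.-tuple V) : GLmx s s (corner_id s).
Proof.
have sIs := in_corner_id s.
split=> //; exists (corner_id s); split=> //; exact: corner_mulmx1 sIs.
Qed.

Lemma GLmx_mul m n p (s : m.-tuple V) (t : n.-tuple V) (u : p.-tuple V) A B :
  GLmx s t A -> GLmx t u B -> GLmx s u (A *m B).
Proof.
move=> [sAt [A' [tA's AA' A'A]]] [tBu [B' [uB't BB' B'B]]].
split; first exact: in_corner_mul sAt tBu.
exists (B' *m A'); split; first exact: in_corner_mul uB't tA's.
- by rewrite mulmxA -(mulmxA A) BB' (corner_mulmx1 sAt).
- by rewrite mulmxA -(mulmxA B') A'A (corner_mulmx1 uB't).
Qed.

Lemma GLmx_inv m n (s : m.-tuple V) (t : n.-tuple V) A B :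
  in_corner s t A -> corner_inverse s t A B -> GLmx t s B.
Proof. by move=> sAt [tBs AB BA]; split=> //; exists A; split. Qed.

End CornerMatrices.

Record groupoid := Groupoid {
  gobj : Type;
  ghom : gobj -> gobj -> Type;
  gidm : forall a, ghom a a;
  gcomp : forall a b c, ghom b c -> ghom a b -> ghom a c;
  ginv : forall a b, ghom a b -> ghom b a;
  _ : forall a b c d (h : ghom c d) (g : ghom b c) (f : ghom a b),
        gcomp h (gcomp g f) = gcomp (gcomp h g) f;
  _ : forall a b (f : ghom a b), gcomp (gidm b) f = f;
  _ : forall a b (f : ghom a b), gcomp f (gidm a) = f;
  _ : forall a b (f : ghom a b), gcomp (ginv f) f = gidm a;
  _ : forall a b (f : ghom a b), gcomp f (ginv f) = gidm b
}.

Section GeneratedSubgroupoid.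
Variables (G : groupoid) (S : forall a b : gobj G, ghom a b -> Prop).

Definition subgroupoid_obj (a : gobj G) : Prop :=
  exists b, (exists f : ghom a b, S f) \/ (exists f : ghom b a, S f).

Inductive subgroupoid_hom : forall a b : gobj G, ghom a b -> Prop :=
| subgroupoid_gen a b (f : ghom a b) : S f -> subgroupoid_hom f
| subgroupoid_inv a b (f : ghom a b) : S f -> subgroupoid_hom (ginv f)
| subgroupoid_comp a b c (g : ghom b c) (f : ghom a b) :
    subgroupoid_hom g -> subgroupoid_hom f -> subgroupoid_hom (gcomp g f).

Definition generates : Prop :=
  (forall a, subgroupoid_obj a) /\
  (forall (a b : gobj G) (f : ghom a b), subgroupoid_hom f).

End GeneratedSubgroupoid.

Section GeneralLinearGroupoid.
Variables (R : pzRingType) (V : Type) (e : V -> R).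
Hypothesis eK : forall v, e v * e v = e v.

(* Hom(s, t) consists of the t x s matrices. *)
Definition gl_hom (s t : word V) : Type :=
  {A : 'M[R]_((wlen t).+1, (wlen s).+1) | GLmx e (wval t) (wval s) A}.

Lemma gl_hom_inj s t (A B : gl_hom s t) : sval A = sval B -> A = B.
Proof. exact: eq_sig_hprop (fun _ => @Prop_irrelevance _) _ _. Qed.

Definition gl_id s : gl_hom s s := exist _ _ (GLmx_id eK (wval s)).

Definition gl_comp s t u (B : gl_hom t u) (A : gl_hom s t) : gl_hom s u :=
  exist _ _ (GLmx_mul eK (svalP B) (svalP A)).

Definition gl_inv s t (A : gl_hom s t) : gl_hom t s :=
  let B := cid (svalP A).2 in
  exist _ (sval B) (GLmx_inv (svalP A).1 (svalP B)).

Lemma gl_compA s t u v (C : gl_hom u v) (B : gl_hom t u) (A : gl_hom s t) :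
  gl_comp C (gl_comp B A) = gl_comp (gl_comp C B) A.
Proof. by apply: gl_hom_inj; rewrite /= mulmxA. Qed.

Lemma gl_comp1m s t (A : gl_hom s t) : gl_comp (gl_id t) A = A.
Proof. by apply: gl_hom_inj; apply: (corner_mul1mx eK (svalP A).1). Qed.

Lemma gl_compm1 s t (A : gl_hom s t) : gl_comp A (gl_id s) = A.
Proof. by apply: gl_hom_inj; apply: (corner_mulmx1 eK (svalP A).1). Qed.

Lemma gl_compVm s t (A : gl_hom s t) : gl_comp (gl_inv A) A = gl_id s.
Proof. by apply: gl_hom_inj; rewrite /=; case: cid => B []. Qed.

Lemma gl_compmV s t (A : gl_hom s t) : gl_comp A (gl_inv A) = gl_id t.
Proof. by apply: gl_hom_inj; rewrite /=; case: cid => B []. Qed.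

Definition gl_groupoid : groupoid :=
  Groupoid gl_compA gl_comp1m gl_compm1 gl_compVm gl_compmV.

End GeneralLinearGroupoid.

Section Generators.
Variables (K : fieldType) (E : digraph) (f : vertex E -> seq (edge E)).
Local Notation L := (lpa K E).
Local Notation V := (vertex E).
Local Notation vtx := (@lpa_vertex K E).

Inductive Fblock : forall m n, 'M[L]_(m, n) -> Prop :=
| Fblock_vertex (v : V) : Fblock (const_mx (vtx v) : 'M_(1, 1))
| Fblock_row (v : V) : regular v ->
    Fblock (\row_j lpa_edge K (tnth (in_tuple (f v)) j))
| Fblock_col (v : V) : regular v ->
    Fblock (\col_j lpa_ghost K (tnth (in_tuple (f v)) j)).

(* diag(A_1, ..., A_l), built by prepending one block at a time. *)
Inductive Fdiag : forall m n, 'M[L]_(m, n) -> Prop :=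
| Fdiag_nil : Fdiag (0 : 'M_(0, 0))
| Fdiag_cons m1 n1 m2 n2 (A : 'M_(m1, n1)) (B : 'M_(m2, n2)) :
    Fblock A -> Fdiag B -> Fdiag (block_mx A 0 0 B).

Definition Fmx m n (s : m.-tuple V) (t : n.-tuple V) (A : 'M[L]_(m, n)) : Prop :=
  GLmx vtx s t A /\ Fdiag A.

Definition Pmx n (s t : n.-tuple V) (P : 'M[L]_n) : Prop :=
  GLmx vtx s t P /\
  exists (p : {perm 'I_n}) (k : 'I_n -> K),
    [/\ forall i, tnth s i = tnth t (p i),
        forall i, k i != 0 &
        forall i j, P i j = if j == p i then k i *: vtx (tnth s i) else 0].

Inductive EFPmx : forall m n, m.-tuple V -> n.-tuple V -> 'M[L]_(m, n) -> Prop :=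
| EFPmx_E m (s : m.-tuple V) A : Emx vtx s A -> EFPmx s s A
| EFPmx_F m n (s : m.-tuple V) (t : n.-tuple V) A : Fmx s t A -> EFPmx s t A
| EFPmx_P n (s t : n.-tuple V) A : Pmx s t A -> EFPmx s t A.

Definition lpa_groupoid : groupoid := gl_groupoid (@lpa_vertexK K E).

Definition EFP (a b : gobj lpa_groupoid) (A : ghom a b) : Prop :=
  EFPmx (wval b) (wval a) (sval A).

End Generators.

(* Main.v *)
From mathcomp Require Import all_boot all_order all_algebra.
From mathcomp Require Import perm generic_quotient boolp.
Require Import Defs.

Set Implicit Arguments.
Unset Strict Implicit.
Unset Printing Implicit Defensive.

Import Order.TTheory GRing.Theory Num.Theory.
Local Open Scope ring_scope.
Local Open Scope quotient_scope.

(** Let P be the path algebra inside L = L(E), the span of the real paths.  An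
    invertible matrix A over L with inverse B is a family of rows a_i with dual
    columns b_i: a_i b_k is the label of i if i = k and 0 otherwise, and the sum
    of the b_i a_i is the identity.  A generator permutes the rows, rescales
    them, adds a multiple of one row to another, or replaces a row a labelled by
    a regular vertex v by the rows f^* a for the edges f leaving v, with dual
    columns b f (an expansion).  The theorem says that such moves ([reach])
    carry each family to the standard basis.

    Entries in P.  Each x in L is carried into P by multiplication on the right
    with sufficiently long paths ([level_exists]).  Expanding the rows of A^-1
    often enough multiplies the dual columns, which are the columns of A, by
    long paths, so it is enough to treat matrices with entries in P
    ([gen_GLmx]).

    Inverse in P.  Let A have entries in P.  As a map between projective right
    P-modules, A is injective, and long paths annihilate its cokernel, so the
    cokernel has finite length with simple factors K v, v regular; the kernel of
    a projection vP -> K v is the image of the row of edges leaving v.  So A is a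
    product of expansions, scalar row operations and a matrix invertible over P.
    Concretely ([reach_of_path_vecs]): if the constant terms of the rows are
    dependent, a combination of rows without constant term can be expanded
    inside P, which lowers the levels of the dual columns; if they are
    independent, a Nakayama argument puts the inverse of A in P
    ([path_covec_of_const_free]).

    Invertible over P.  P is graded by length and has a weak algorithm in the
    sense of Cohn, as free algebras have: in A^-1 A = 1 the parts of top degree
    cancel, so the leading forms of the rows of A are dependent, and an
    elementary operation lowers the degree of a row ([weak_algorithm]).  Once
    all the degrees are zero, Gauss-Jordan elimination over K remains
    ([gauss_jordan]).

    The argument uses that paths of different lengths are independent in L and
    that vertices are nonzero; a graded representation of L shows both. *)

(** * Relations in the Leavitt path algebra *)

Section LeavittRelations.
Variables (K : fieldType) (E : digraph).
Local Notation L := (lpa K E).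
Local Notation V := (vertex E).
Local Notation vtx := (@lpa_vertex K E).
Local Notation edg := (@lpa_edge K E).
Local Notation gho := (@lpa_ghost K E).

Lemma vtx_edge v e : vtx v * edg e = if src e == v then edg e else 0.
Proof.
have se : vtx (src e) * edg e = edg e.
  by rewrite [LHS]pi_mul; apply/lpaP/lpa_se.
case: eqP => [<-//|/eqP ev]; rewrite -se mulrA lpa_vertexM eq_sym (negPf ev).
by rewrite mul0r.
Qed.

Lemma edge_tgt e : edg e * vtx (tgt e) = edg e.
Proof. by rewrite [LHS]pi_mul; apply/lpaP/lpa_er. Qed.

Lemma tgt_ghost e : vtx (tgt e) * gho e = gho e.
Proof. by rewrite [LHS]pi_mul; apply/lpaP/lpa_rg. Qed.

Lemma ghost_vtx e v : gho e * vtx v = if src e == v then gho e else 0.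
Proof.
have gs : gho e * vtx (src e) = gho e.
  by rewrite [LHS]pi_mul; apply/lpaP/lpa_gs.
case: eqP => [<-//|/eqP ev]; rewrite -gs -mulrA lpa_vertexM (negPf ev).
by rewrite mulr0.
Qed.

Lemma ghost_edge e e' : gho e * edg e' = if e == e' then vtx (tgt e) else 0.
Proof.
rewrite [LHS]pi_mul; have /lpaP-> := lpa_ge K e e'; by case: (e == e').
Qed.

Lemma sum_edge_ghost v : regular v ->
  \sum_(e <- enum (out_edges v)) edg e * gho e = vtx v.
Proof.
move=> vreg; have /lpaP := lpa_eg K vreg.
rewrite -[X in _ = X -> _]/(vtx v) => <-; elim: (enum _) => [|e s IHs];
    first by rewrite !big_nil.
by rewrite !big_cons IHs -pi_add -!pi_mul.
Qed.

Lemma ghost_sum e (z : edge E -> L) :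
  gho e * (\sum_e' edg e' * z e') = vtx (tgt e) * z e.
Proof.
rewrite mulr_sumr (bigD1 e) //= mulrA ghost_edge eqxx big1 ?addr0 // => e' /negPf.
by rewrite mulrA ghost_edge eq_sym => ->; rewrite mul0r.
Qed.

(** * A graded representation *)

(** The functions on V x nat x Z, on which L acts.  Fix bijections between
    {v} x nat and the disjoint union, over the edges e leaving v, of
    {tgt e} x nat: an edge acts by shifting a function along the bijection and
    a ghost edge shifts back, so that the relations (i)-(iv) hold.  The third
    coordinate records the degree.  The bijections come from division with
    remainder by the number of edges leaving v.  The action is what shows that
    vertices are nonzero in L and independent of longer paths. *)
Definition graded_module : Type := V -> nat -> int -> K.

Definition out_degree (v : V) : nat := #|out_edges v|.
Definition out_rank (e : edge E) : nat := index e (enum (out_edges (src e))).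

Fixpoint act_term (t : lpa_term K E) (g : graded_module) : graded_module :=
  match t with
  | TVertex v => fun w n k => if w == v then g w n k else 0
  | TEdge e => fun w n k =>
      if (w == src e) && (n %% out_degree w == out_rank e)%N
      then g (tgt e) (n %/ out_degree w)%N (k - 1) else 0
  | TGhost e => fun w n k =>
      if w == tgt e
      then g (src e) (n * out_degree (src e) + out_rank e)%N (k + 1) else 0
  | TZero => fun _ _ _ => 0
  | TAdd x y => fun w n k => act_term x g w n k + act_term y g w n k
  | TOpp x => fun w n k => - act_term x g w n k
  | TScale c x => fun w n k => c * act_term x g w n k
  | TMul x y => act_term x (act_term y g)
  end.

Lemma act_termD t (g h : graded_module) :
  act_term t (fun w n k => g w n k + h w n k) =
  fun w n k => act_term t g w n k + act_term t h w n k.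
Proof.
elim: t g h => [v|e|e||x IHx y IHy|x IHx|c x IHx|x IHx y IHy] g h;
  do 3!apply: funext => ? /=.
- by case: ifP => //; rewrite addr0.
- by case: ifP => //; rewrite addr0.
- by case: ifP => //; rewrite addr0.
- by rewrite addr0.
- by rewrite IHx IHy addrACA.
- by rewrite IHx opprD.
- by rewrite IHx mulrDr.
- by rewrite IHy IHx.
Qed.

Lemma act_termZ t c (g : graded_module) :
  act_term t (fun w n k => c * g w n k) = fun w n k => c * act_term t g w n k.
Proof.
elim: t g => [v|e|e||x IHx y IHy|x IHx|d x IHx|x IHx y IHy] g;
  do 3!apply: funext => ? /=.
- by case: ifP => //; rewrite mulr0.
- by case: ifP => //; rewrite mulr0.
- by case: ifP => //; rewrite mulr0.
- by rewrite mulr0.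
- by rewrite IHx IHy mulrDr.
- by rewrite IHx mulrN.
- by rewrite IHx mulrCA.
- by rewrite IHy IHx.
Qed.

Lemma out_rank_lt e : (out_rank e < out_degree (src e))%N.
Proof. by rewrite /out_degree cardE index_mem mem_enum inE. Qed.

(** The bijection between {v} x nat and the sets {tgt e} x nat sends (v, n) to
    the edge whose rank is the remainder of n and to the quotient of n; it makes
    relations (iii) and (iv) hold. *)
Lemma act_term_rel x y : lpa_rel x y -> act_term x = act_term y.
Proof.
elim=> {x y}.
- by [].
- by move=> x y _ ->.
- by move=> x y z _ -> _ ->.
- by move=> x x' y y' _ IH1 _ IH2; apply: funext => g /=; rewrite IH1 IH2.
- by move=> x x' _ IH1; apply: funext => g /=; rewrite IH1.
- by move=> k x x' _ IH1; apply: funext => g /=; rewrite IH1.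
- by move=> x x' y y' _ IH1 _ IH2; apply: funext => g /=; rewrite IH1 IH2.
- by move=> x y z; do 4!apply: funext => ? /=; rewrite addrA.
- by move=> x y; do 4!apply: funext => ? /=; rewrite addrC.
- by move=> x; do 4!apply: funext => ? /=; rewrite add0r.
- by move=> x; do 4!apply: funext => ? /=; rewrite addNr.
- by move=> a b x; do 4!apply: funext => ? /=; rewrite mulrA.
- by move=> x; do 4!apply: funext => ? /=; rewrite mul1r.
- by move=> a x y; do 4!apply: funext => ? /=; rewrite mulrDr.
- by move=> a b x; do 4!apply: funext => ? /=; rewrite mulrDl.
- by [].
- by [].
- by move=> x y z; apply: funext => g /=; rewrite act_termD.
- by [].
- by move=> a x y; apply: funext => g /=; rewrite act_termZ.
- move=> u v; do 4!apply: funext => ? /=.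
  case: (altP (u =P v)) => [<-|uv] /=; first by case: eqP.
  by case: eqP => // ->; rewrite (negPf uv).
- by move=> e; do 4!apply: funext => ? /=; case: eqP.
- by move=> e; do 4!apply: funext => ? /=; rewrite eqxx.
- by move=> e; do 4!apply: funext => ? /=; case: eqP.
- by move=> e; do 4!apply: funext => ? /=; rewrite eqxx.
- move=> e f; apply: funext => g; do 3!apply: funext => ? /=.
  case: (altP (e =P f)) => [<-|ef] /=.
    case: eqP => // ->; have lt := out_rank_lt e.
    have d0 := leq_ltn_trans (leq0n _) lt.
    rewrite eqxx modnMDl modn_small // eqxx /= divnMDl // divn_small // addn0.
    by rewrite addrK.
  case: eqP => // _; case: eqP => //= sef; rewrite modnMDl modn_small ?out_rank_lt //.
  case: eqP => // rk; case/eqP: ef.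
  apply: (@index_inj _ e (enum (out_edges (src e)))) => //;
      rewrite ?mem_enum ?inE ?sef //.
  by move: rk; rewrite /out_rank sef.
- move=> v vreg; apply: funext => g; apply: funext => w; apply: funext => n;
    apply: funext => k /=.
  have -> s : act_term (\big[@TAdd K E/@TZero K E]_(e <- s) TMul (TEdge K e) (TGhost K e)) g w n k
     = \sum_(e <- s) act_term (TMul (TEdge K e) (TGhost K e)) g w n k.
    by elim: s => [|e s IHs]; rewrite ?big_nil ?big_cons //= IHs.
  case: (altP (w =P v)) => [->|wv]; last first.
    rewrite big_seq big1 // => e; rewrite mem_enum inE => /eqP ev /=.
    by rewrite ev (negPf wv).
  have d0 : (0 < out_degree v)%N by [].
  have szE : size (enum (out_edges v)) = out_degree v by rewrite /out_degree cardE.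
  have lt : (n %% out_degree v < size (enum (out_edges v)))%N.
    by rewrite szE ltn_mod.
  (* The only edge that contributes to the sum at (v, n) is the one whose rank
     is the remainder of n. *)
  have e0 : edge E by case: (enum _) lt.
  pose e := nth e0 (enum (out_edges v)) (n %% out_degree v).
  have ein : e \in enum (out_edges v) by apply: mem_nth.
  have es : src e = v by move: ein; rewrite mem_enum inE => /eqP.
  have rke : out_rank e = (n %% out_degree v)%N.
    by rewrite /out_rank es index_uniq // enum_uniq.
  rewrite (bigD1_seq e) ?enum_uniq //= es !eqxx rke eqxx /= -divn_eq subrK.
  rewrite big_seq_cond big1 ?addr0 // => e' /andP[].
  rewrite mem_enum inE => /eqP es' ne; rewrite es' eqxx /=.
  case: eqP => // rk; case/eqP: ne.
  have ein' : e' \in enum (out_edges v) by rewrite mem_enum inE es'.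
  apply: (@index_inj _ e (enum (out_edges v))) => //.
  by move: rke; rewrite rk /out_rank es es'.
Qed.

Definition act (x : L) : graded_module -> graded_module := act_term (repr x).

Lemma act_pi t : act (\pi_L t) = act_term t.
Proof. exact/act_term_rel/lpa_reprP. Qed.

Lemma actD x y g w n k : act (x + y) g w n k = act x g w n k + act y g w n k.
Proof.
elim/lpa_ind: x => x; elim/lpa_ind: y => y.
by rewrite [_ + _]pi_add !act_pi.
Qed.

Lemma actZ c x g w n k : act (c *: x) g w n k = c * act x g w n k.
Proof. by elim/lpa_ind: x => x; rewrite [_ *: _]pi_scale !act_pi. Qed.

Lemma actM x y g : act (x * y) g = act x (act y g).
Proof.
elim/lpa_ind: x => x; elim/lpa_ind: y => y.
by rewrite [_ * _]pi_mul !act_pi.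
Qed.


Lemma act_vtx v g w n k : act (vtx v) g w n k = if w == v then g w n k else 0.
Proof. by rewrite act_pi. Qed.

Lemma act_edge e g w n k : act (edg e) g w n k =
  if (w == src e) && (n %% out_degree w == out_rank e)%N
  then g (tgt e) (n %/ out_degree w)%N (k - 1) else 0.
Proof. by rewrite act_pi. Qed.

Lemma act0 g w n k : act (0 : L) g w n k = 0.
Proof. by rewrite act_pi. Qed.

Lemma act_sum (I : Type) (r : seq I) (P : pred I) (F : I -> L) g w n k :
  act (\sum_(i <- r | P i) F i) g w n k = \sum_(i <- r | P i) act (F i) g w n k.
Proof.
apply: (big_morph (fun x : L => act x g w n k)) => [x y|]; first exact: actD.
exact: act0.
Qed.

(** * The path algebra and its constant coefficients *)

(** The span of the real paths of length less than d.  Splitting off the first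
    edge makes both this and [homog] recursive in d. *)
Fixpoint deg_lt (d : nat) (x : L) : Prop :=
  if d is d'.+1 then
    exists c z, x = \sum_v c v *: vtx v + \sum_e edg e * z e /\
                forall e, deg_lt d' (z e)
  else x = 0.

(** The span of the real paths of length d. *)
Fixpoint homog (d : nat) (x : L) : Prop :=
  if d is d'.+1 then
    exists z, x = \sum_e edg e * z e /\ forall e, homog d' (z e)
  else exists c, x = \sum_v c v *: vtx v.

(** Read off by applying x to the indicator function of degree 0: elements of
    the path algebra do not lower degrees, so a path of positive length
    contributes nothing in degree 0. *)
Definition const_coef (v : V) (x : L) : K :=
  act x (fun _ _ k => (k == 0)%:R) v 0%N 0.

Lemma const_coefD v x y : const_coef v (x + y) = const_coef v x + const_coef v y.
Proof. exact: actD. Qed.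

Lemma const_coef0 v : const_coef v 0 = 0.
Proof. exact: act0. Qed.

Lemma const_coefZ v c x : const_coef v (c *: x) = c * const_coef v x.
Proof. exact: actZ. Qed.

Lemma const_coef_sum v (I : Type) (r : seq I) (P : pred I) (F : I -> L) :
  const_coef v (\sum_(i <- r | P i) F i) = \sum_(i <- r | P i) const_coef v (F i).
Proof. exact: act_sum. Qed.

Lemma const_coef_vtx v w : const_coef v (vtx w) = (v == w)%:R.
Proof. by rewrite /const_coef act_vtx eqxx; case: (v == w). Qed.

Lemma act_deg_lt d x (g : graded_module) : deg_lt d x ->
  (forall w n k, (k < 0)%R -> g w n k = 0) ->
  forall w n k, (k < 0)%R -> act x g w n k = 0.
Proof.
move=> + g0; elim: d x => [|d IHd] x /=.
  by move=> -> w n k _; apply: act0.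
case=> c [z [-> zP]] w n k k0.
rewrite actD !act_sum !big1 ?addr0 // => [e _|v _].
  rewrite actM act_edge; case: ifP => // _.
  by apply: IHd => //; apply: lt_trans k0; rewrite gtrBl.
by rewrite actZ act_vtx g0 // if_same mulr0.
Qed.

Lemma const_coef_edge d v e x : deg_lt d x -> const_coef v (edg e * x) = 0.
Proof.
move=> xP; rewrite /const_coef actM act_edge; case: ifP => // _.
by apply: act_deg_lt xP _ _ _ _ _ => // w n k; case: eqP => // ->.
Qed.

Lemma const_coef_deg_lt v c (z : edge E -> L) d : (forall e, deg_lt d (z e)) ->
  const_coef v (\sum_v c v *: vtx v + \sum_e edg e * z e) = c v.
Proof.
move=> zP; rewrite const_coefD !const_coef_sum (bigD1 v) //= big1 => [|w wv].
  rewrite const_coefZ const_coef_vtx eqxx mulr1 addr0 big1 ?addr0 // => e _.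
  exact: const_coef_edge (zP e).
by rewrite const_coefZ const_coef_vtx eq_sym (negPf wv) mulr0.
Qed.

Lemma vtx_neq0 v : vtx v != 0.
Proof.
apply/eqP => /(congr1 (const_coef v)); rewrite const_coef_vtx eqxx const_coef0.
by move/eqP; rewrite oner_eq0.
Qed.

Lemma sum_vtx_pick (c : V -> K) v :
  \sum_w (if w == v then c w else 0) *: vtx w = c v *: vtx v.
Proof.
rewrite (bigD1 v) //= eqxx big1 ?addr0 // => w /negPf->; exact: scale0r.
Qed.

Lemma vtx_sum v (c : V -> K) : vtx v * (\sum_w c w *: vtx w) = c v *: vtx v.
Proof.
rewrite mulr_sumr (bigD1 v) //= -lpa_scalerAr lpa_vertexK big1 ?addr0 // => w wv.
by rewrite -lpa_scalerAr lpa_vertexM eq_sym (negPf wv) scaler0.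
Qed.

Lemma vtx_sum_edge v (z : edge E -> L) :
  vtx v * (\sum_e edg e * z e) = \sum_e edg e * (if src e == v then z e else 0).
Proof.
rewrite mulr_sumr; apply: eq_bigr => e _.
by rewrite mulrA vtx_edge; case: ifP; rewrite ?mul0r ?mulr0.
Qed.

Lemma deg_lt0 d : deg_lt d 0.
Proof.
elim: d => [|d IHd] //=; exists (fun=> 0), (fun=> 0); split=> //.
by rewrite !big1 ?addr0 // => i _; rewrite ?scale0r ?mulr0.
Qed.

Lemma deg_ltD d x y : deg_lt d x -> deg_lt d y -> deg_lt d (x + y).
Proof.
elim: d x y => [|d IHd] x y /=; first by move=> -> ->; rewrite addr0.
case=> c [z [-> zP]] [c' [z' [-> zP']]].
exists (fun v => c v + c' v), (fun e => z e + z' e); split=> [|e]; last exact: IHd.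
rewrite addrACA -!big_split /=; congr (_ + _); apply: eq_bigr => i _.
  by rewrite scalerDl.
by rewrite mulrDr.
Qed.

Lemma deg_ltZ d k x : deg_lt d x -> deg_lt d (k *: x).
Proof.
elim: d x => [|d IHd] x /=; first by move=> ->; rewrite scaler0.
case=> c [z [-> zP]]; exists (fun v => k * c v), (fun e => k *: z e).
split=> [|e]; last exact: IHd.
rewrite scalerDr !scaler_sumr; congr (_ + _); apply: eq_bigr => i _.
  by rewrite scalerA.
by rewrite lpa_scalerAr.
Qed.

Lemma deg_ltN d x : deg_lt d x -> deg_lt d (- x).
Proof. by rewrite -scaleN1r; apply: deg_ltZ. Qed.

Lemma deg_ltB d x y : deg_lt d x -> deg_lt d y -> deg_lt d (x - y).
Proof. by move=> xP yP; apply/deg_ltD/deg_ltN. Qed.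

Lemma deg_lt_sum d (I : Type) (r : seq I) (P : pred I) (F : I -> L) :
  (forall i, P i -> deg_lt d (F i)) -> deg_lt d (\sum_(i <- r | P i) F i).
Proof. by move=> FP; elim/big_ind: _ => //; [apply: deg_lt0|apply: deg_ltD]. Qed.

Lemma deg_lt_edge d e x : deg_lt d x -> deg_lt d.+1 (edg e * x).
Proof.
move=> xP; exists (fun=> 0), (fun e' => if e' == e then x else 0); split.
  rewrite big1 => [|i _]; last exact: scale0r.
  rewrite add0r (bigD1 e) //= eqxx big1 ?addr0 // => e' /negPf->.
  by rewrite mulr0.
by move=> e'; case: ifP => // _; apply: deg_lt0.
Qed.

Lemma deg_lt_vtx d v : deg_lt d.+1 (vtx v).
Proof.
exists (fun w => if w == v then 1 else 0), (fun=> 0); split=> [|e]; last exact: deg_lt0.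
rewrite (sum_vtx_pick (fun=> 1)) scale1r big1 ?addr0 // => e _; exact: mulr0.
Qed.

Lemma deg_lt_mono d d' x : (d <= d')%N -> deg_lt d x -> deg_lt d' x.
Proof.
elim: d d' x => [|d IHd] [|d'] x //= dd'.
  by move=> ->; apply: (deg_lt0 d'.+1).
case=> c [z [-> zP]]; exists c, z; split=> // e; exact: IHd (zP e).
Qed.

Lemma deg_lt_vtxl d v y : deg_lt d y -> deg_lt d (vtx v * y).
Proof.
case: d => [->|d [c [z [-> zP]]]]; first by rewrite mulr0.
rewrite mulrDr vtx_sum vtx_sum_edge; apply/deg_ltD; first exact/deg_ltZ/deg_lt_vtx.
apply: deg_lt_sum => e _; apply: deg_lt_edge; case: ifP => _; first exact: zP.
exact: deg_lt0.
Qed.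

Lemma deg_ltM d d' x y : deg_lt d.+1 x -> deg_lt d' y -> deg_lt (d + d') (x * y).
Proof.
elim: d x => [|d IHd] x [c [z [-> zP]]] yP; rewrite mulrDl !mulr_suml; apply: deg_ltD.
- by apply: deg_lt_sum => v _; rewrite -lpa_scalerAl add0n; apply/deg_ltZ/deg_lt_vtxl.
- rewrite big1; first exact: deg_lt0.
  by move=> e _; rewrite (zP e) mulr0 mul0r.
- apply: deg_lt_sum => v _; rewrite -lpa_scalerAl; apply: deg_ltZ.
  by apply: (@deg_lt_mono d'); rewrite ?leq_addl //; apply: deg_lt_vtxl.
- apply: deg_lt_sum => e _; rewrite -mulrA addSn; apply: deg_lt_edge.
  exact: IHd.
Qed.

Definition pathpol x : Prop := exists d, deg_lt d x.

End LeavittRelations.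

(** * Homogeneous and proper elements *)

Section PathAlgebra.
Variables (K : fieldType) (E : digraph).
Local Notation L := (lpa K E).
Local Notation vtx := (@lpa_vertex K E).
Local Notation edg := (@lpa_edge K E).
Local Notation gho := (@lpa_ghost K E).
Local Notation deg_lt := (@deg_lt K E).
Local Notation homog := (@homog K E).
Local Notation pathpol := (@pathpol K E).

Lemma pathpol0 : pathpol 0.
Proof. by exists 0%N. Qed.

Lemma pathpolD x y : pathpol x -> pathpol y -> pathpol (x + y).
Proof.
move=> [d xP] [d' yP]; exists (maxn d d'); apply: deg_ltD.
  by apply: deg_lt_mono xP; rewrite leq_maxl.
by apply: deg_lt_mono yP; rewrite leq_maxr.
Qed.

Lemma pathpolZ k x : pathpol x -> pathpol (k *: x).
Proof. by case=> d xP; exists d; apply: deg_ltZ. Qed.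

Lemma pathpolN x : pathpol x -> pathpol (- x).
Proof. by case=> d xP; exists d; apply: deg_ltN. Qed.

Lemma pathpolM x y : pathpol x -> pathpol y -> pathpol (x * y).
Proof.
move=> [d xP] [d' yP]; exists (d + d')%N; apply: deg_ltM yP.
exact: deg_lt_mono (leqnSn d) xP.
Qed.

Lemma pathpol_sum (I : Type) (r : seq I) (P : pred I) (F : I -> L) :
  (forall i, P i -> pathpol (F i)) -> pathpol (\sum_(i <- r | P i) F i).
Proof. by move=> FP; elim/big_ind: _ => //; [apply: pathpol0|apply: pathpolD]. Qed.

Lemma pathpol_vtx v : pathpol (vtx v).
Proof. by exists 1%N; apply: deg_lt_vtx. Qed.

Lemma pathpol_edge e : pathpol (edg e).
Proof. by exists 2%N; rewrite -(edge_tgt K e); apply/deg_lt_edge/deg_lt_vtx. Qed.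

Lemma bigmaxP (I : finType) (P : I -> nat -> Prop) :
  (forall i m n, (m <= n)%N -> P i m -> P i n) ->
  (forall i, exists n, P i n) -> exists n, forall i, P i n.
Proof.
move=> mono exP; have [f fP] := choice exP.
exists (\max_i f i) => i; apply: mono (fP i); exact: leq_bigmax.
Qed.

Lemma homogD d x y : homog d x -> homog d y -> homog d (x + y).
Proof.
elim: d x y => [|d IHd] x y /=.
  case=> c -> [c' ->]; exists (fun v => c v + c' v).
  by rewrite -big_split; apply: eq_bigr => v _; rewrite scalerDl.
case=> z [-> zP] [z' [-> zP']]; exists (fun e => z e + z' e).
split=> [|e]; last exact: IHd.
by rewrite -big_split; apply: eq_bigr => v _; rewrite mulrDr.
Qed.

Lemma homog0 d : homog d 0.
Proof.
elim: d => [|d IHd] /=.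
  by exists (fun=> 0); rewrite big1 // => v _; rewrite scale0r.
by exists (fun=> 0); split=> //; rewrite big1 // => e _; rewrite mulr0.
Qed.

Lemma homogZ d k x : homog d x -> homog d (k *: x).
Proof.
elim: d x => [|d IHd] x /=.
  case=> c ->; exists (fun v => k * c v).
  by rewrite scaler_sumr; apply: eq_bigr => v _; rewrite scalerA.
case=> z [-> zP]; exists (fun e => k *: z e).
split=> [|e]; last exact: IHd.
by rewrite scaler_sumr; apply: eq_bigr => v _; rewrite lpa_scalerAr.
Qed.

Lemma homog_sum d (I : Type) (r : seq I) (P : pred I) (F : I -> L) :
  (forall i, P i -> homog d (F i)) -> homog d (\sum_(i <- r | P i) F i).
Proof. by move=> FP; elim/big_ind: _ => //; [apply: homog0|apply: homogD]. Qed.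

Lemma homog_vtx v : homog 0 (vtx v).
Proof.
exists (fun w => if w == v then 1 else 0).
by rewrite (sum_vtx_pick (fun=> 1)) scale1r.
Qed.

Lemma homog_edge d e x : homog d x -> homog d.+1 (edg e * x).
Proof.
move=> xP; exists (fun e' => if e' == e then x else 0); split.
  by rewrite (bigD1 e) //= eqxx big1 ?addr0 // => e' /negPf->; rewrite mulr0.
by move=> e'; case: ifP => // _; apply: homog0.
Qed.

Lemma homog_vtxl d v x : homog d x -> homog d (vtx v * x).
Proof.
case: d => [|d] [c].
  by move=> ->; rewrite vtx_sum; apply/homogZ/homog_vtx.
case=> -> zP; rewrite vtx_sum_edge; apply: homog_sum => e _; apply: homog_edge.
by case: ifP => _; [exact: zP | exact: homog0].
Qed.

Lemma homogM d d' x y : homog d x -> homog d' y -> homog (d + d') (x * y).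
Proof.
elim: d x => [|d IHd] x [c].
  move=> -> yP; rewrite mulr_suml; apply: homog_sum => v _.
  by rewrite -lpa_scalerAl; apply/homogZ/homog_vtxl.
case=> -> zP yP; rewrite mulr_suml addSn; apply: homog_sum => e _.
rewrite -mulrA; exact: homog_edge (IHd _ (zP e) yP).
Qed.

Lemma homog_deg_lt d x : homog d x -> deg_lt d.+1 x.
Proof.
elim: d x => [|d IHd] x [c].
  move=> ->; apply: deg_lt_sum => v _; exact/deg_ltZ/deg_lt_vtx.
case=> -> zP; apply: deg_lt_sum => e _; exact: deg_lt_edge (IHd _ (zP e)).
Qed.

Lemma homog_ghost d e x : homog d.+1 x -> homog d (gho e * x).
Proof. by case=> z [-> zP]; rewrite ghost_sum; exact: homog_vtxl (zP e). Qed.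

(** An element of positive degree is the sum of e (e^* x). *)
Lemma homog_ghost_eq0 d x : homog d.+1 x -> (forall e, gho e * x = 0) -> x = 0.
Proof.
case=> z [-> zP] x0; rewrite big1 // => e _.
by have := x0 e; rewrite ghost_sum -(edge_tgt K e) -mulrA => ->; rewrite mulr0.
Qed.

Lemma deg_lt_split d x : deg_lt d.+1 x -> exists2 h, homog d h & deg_lt d (x - h).
Proof.
elim: d x => [|d IHd] x.
  case=> c [z [-> zP]]; exists (\sum_v c v *: vtx v); first by exists c.
  by rewrite addrAC subrr add0r; apply: big1 => e _; rewrite (zP e) mulr0.
case=> c [z [-> zP]]; have /choice[h hP] : forall e, exists h, homog d h /\
    deg_lt d (z e - h).
  by move=> e; have [h ? ?] := IHd _ (zP e); exists h.
exists (\sum_e edg e * h e).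
  by apply: homog_sum => e _; apply/homog_edge; case: (hP e).
rewrite -addrA -sumrB; apply: deg_ltD.
  by apply: deg_lt_sum => v _; apply/deg_ltZ/deg_lt_vtx.
by apply: deg_lt_sum => e _; rewrite -mulrBr; apply: deg_lt_edge; case: (hP e).
Qed.

(** Real paths of different lengths are independent in L.  Comparing constant
    coefficients removes the constant part of the second expression; then e^*
    lowers both degrees by one. *)
Lemma homog_deg_lt_eq0 d x : homog d x -> deg_lt d x -> x = 0.
Proof.
elim: d x => [|d IHd] x //; case=> z [xE zP] [c [y [xE' yP]]].
have c0 v : c v = 0.
  rewrite -(const_coef_deg_lt v c yP) -xE' xE const_coef_sum big1 // => e _.
  exact: (@const_coef_edge _ _ d.+1 v e (z e) (homog_deg_lt (zP e))).
move: xE'; rewrite big1 => [|v _]; last by rewrite c0 scale0r.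
rewrite add0r => xE'; apply: (@homog_ghost_eq0 d); first by exists z.
move=> e; apply: IHd; first by rewrite xE ghost_sum; exact: homog_vtxl (zP e).
by rewrite xE' ghost_sum; exact: deg_lt_vtxl (yP e).
Qed.

Lemma homog0_corner v w x : homog 0 x -> vtx v * x * vtx w = x ->
  exists2 c, x = c *: vtx v & (v != w -> c = 0).
Proof.
case=> c -> <-; rewrite vtx_sum -lpa_scalerAl lpa_vertexM.
case: eqP => [->|vw]; first by exists (c w).
by exists 0; rewrite ?scale0r ?scaler0.
Qed.

(** The elements of the path algebra without constant term. *)
Definition proper x : Prop :=
  exists2 z, x = \sum_e edg e * z e & forall e, pathpol (z e).

Lemma proper_split v x : pathpol x -> vtx v * x = x ->
  exists2 y, x = const_coef v x *: vtx v + y & proper y.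
Proof.
case=> [[xP vx|d [c [z [xE zP]]] vx]].
  exists 0; first by rewrite xP const_coef0 scale0r addr0.
  by exists (fun=> 0) => [|e]; [rewrite big1 // => e _; rewrite mulr0|exact: pathpol0].
exists (\sum_e edg e * (if src e == v then z e else 0)).
  by rewrite -{1}vx xE mulrDr vtx_sum vtx_sum_edge (const_coef_deg_lt v c zP).
exists (fun e => if src e == v then z e else 0) => // e.
by case: ifP => _; [exists d; exact: zP|exact: pathpol0].
Qed.

Lemma const_coef_proper v x : proper x -> const_coef v x = 0.
Proof.
case=> z -> zP; rewrite const_coef_sum big1 // => e _.
by have [d zd] := zP e; apply: const_coef_edge zd.
Qed.

Lemma properMr x y : proper x -> pathpol y -> proper (x * y).
Proof.
case=> z -> zP yP; exists (fun e => z e * y) => [|e]; last exact: pathpolM.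
by rewrite mulr_suml; apply: eq_bigr => e _; rewrite mulrA.
Qed.

Lemma properD x y : proper x -> proper y -> proper (x + y).
Proof.
move=> [z -> zP] [z' -> zP']; exists (fun e => z e + z' e) => [|e];
    last exact: pathpolD.
by rewrite -big_split /=; apply: eq_bigr => e _; rewrite mulrDr.
Qed.

Lemma proper0 : proper 0.
Proof.
by exists (fun=> 0) => [|e]; [rewrite big1 // => e _; rewrite mulr0|exact: pathpol0].
Qed.

(** What makes the expansion of a row possible inside the path algebra: a ghost
    edge cancels the first edge of each path, and there is no constant term on
    which it could remain. *)
Lemma ghost_proper e x : proper x -> pathpol (gho e * x).
Proof.
by case=> z -> zP; rewrite ghost_sum; apply: pathpolM (zP e); apply: pathpol_vtx.
Qed.

(** * Clearing ghost edges *)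

(** [level N y] says that y p lies in the path algebra for each path p that has
    length N, or that is shorter and ends in a sink. *)
Fixpoint level (N : nat) (y : L) : Prop :=
  if N is N'.+1 then
    (forall v, ~~ regular v -> pathpol (y * vtx v)) /\ (forall e, level N' (y * edg e))
  else pathpol y.

Lemma levelD N x y : level N x -> level N y -> level N (x + y).
Proof.
elim: N x y => [|N IHN] x y /=; first exact: pathpolD.
move=> [xs xe] [ys ye]; split=> [v vs|e]; rewrite mulrDl.
  by apply: pathpolD; [apply: xs|apply: ys].
exact: IHN.
Qed.

Lemma level0 N : level N 0.
Proof.
elim: N => [|N IHN] /=; first exact: pathpol0.
by split=> *; rewrite mul0r //; apply: pathpol0.
Qed.

Lemma level_sum N (I : Type) (r : seq I) (P : pred I) (F : I -> L) :
  (forall i, P i -> level N (F i)) -> level N (\sum_(i <- r | P i) F i).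
Proof. by move=> FP; elim/big_ind: _ => //; [apply: level0|apply: levelD]. Qed.

Lemma levelZ N k y : level N y -> level N (k *: y).
Proof.
elim: N y => [|N IHN] y /=; first exact: pathpolZ.
move=> [ys ye]; split=> [v vs|e]; rewrite -lpa_scalerAl.
  by apply/pathpolZ/ys.
exact: IHN.
Qed.

Lemma levelS N y : level N y -> level N.+1 y.
Proof.
elim: N y => [|N IHN] y.
  by move=> yP; split=> *; apply: pathpolM => //;
      [exact: pathpol_vtx|exact: pathpol_edge].
by case=> ys ye; split=> // e; apply/IHN/ye.
Qed.

Lemma level_mono N N' y : (N <= N')%N -> level N y -> level N' y.
Proof.
move/subnK <-; elim: (N' - N)%N => // k IHk yN; rewrite addSn; exact/levelS/IHk.
Qed.

Lemma level_edge N y e : level N y -> level N (y * edg e).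
Proof.
case: N => [yP|N [_ ye]]; last exact/levelS/ye.
by apply: pathpolM => //; apply: pathpol_edge.
Qed.

Lemma level_vtx N y v : level N y -> level N (y * vtx v).
Proof.
case: N => [yP|N [ys ye]]; first by apply: pathpolM => //; apply: pathpol_vtx.
split=> [w ws|e]; rewrite -mulrA.
  rewrite lpa_vertexM; case: eqP => [->|_]; first exact: ys.
  by rewrite mulr0; apply: pathpol0.
rewrite vtx_edge; case: ifP => _; first exact: ye.
by rewrite mulr0; apply: level0.
Qed.

Lemma level_sink N y v : ~~ regular v -> level N y -> pathpol (y * vtx v).
Proof.
move=> vs; case: N => [yP|N [ys _]]; last exact: ys.
by apply: pathpolM => //; apply: pathpol_vtx.
Qed.

Lemma levelMr N y x : level N y -> pathpol x -> level N (y * x).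
Proof.
move=> + [d]; elim: d x y => [|d IHd] x y yN.
  by move=> ->; rewrite mulr0; apply: level0.
case=> c [z [-> zP]]; rewrite mulrDr !mulr_sumr; apply: levelD; apply: level_sum => i _.
  by rewrite -lpa_scalerAr; apply/levelZ/level_vtx.
by rewrite mulrA; exact: IHd (level_edge _ yN) (zP i).
Qed.

(** Each monomial of x ends in a string of ghost edges, and multiplication by a
    path cancels these one by one.  A ghost edge has level 1, and levels add up
    in products: y sends long paths to combinations of long paths, which x then
    sends into the path algebra. *)
Lemma level_exists (x : L) : exists N, level N x.
Proof.
elim/lpa_ind: x;
    elim=> [v|e|e||x [N xN] y [N' yN]|x [N xN]|k x [N xN]|x [N xN] y [N' yN]].
- by exists 0%N; apply: pathpol_vtx.
- by exists 0%N; apply: pathpol_edge.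
- exists 1%N; split=> [v vs|e'].
    have := ghost_vtx K e v; rewrite [gho e]/lpa_ghost => ->.
    case: eqP => [ev|_]; last exact: pathpol0.
    case/negP: vs; rewrite -ev; apply/card_gt0P; exists e; by rewrite inE.
  have := ghost_edge K e e'; rewrite [gho e]/lpa_ghost => ->.
  by case: eqP => _; [apply: pathpol_vtx|apply: pathpol0].
- by exists 0%N; apply: pathpol0.
- exists (maxn N N'); rewrite -pi_add; apply: levelD.
    by apply: level_mono xN; rewrite leq_maxl.
  by apply: level_mono yN; rewrite leq_maxr.
- by exists N; rewrite -pi_opp -[lpa_opp _]/(- \pi_L x) -scaleN1r; apply: levelZ.
- by exists N; rewrite -pi_scale; apply: levelZ.
- exists (N + N')%N; rewrite -pi_mul; move: (\pi_L x) xN (\pi_L y) yN => {x y}.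
  elim: N' => [|N' IHN] x xN y yN; first by rewrite addn0; apply: levelMr.
  case: yN => ys ye; rewrite addnS; split=> [v vs|e]; rewrite -mulrA.
    have := level_sink vs (levelMr xN (ys v vs)).
    by rewrite -!mulrA lpa_vertexK.
  exact: IHN _ xN _ (ye e).
Qed.

End PathAlgebra.

(** * Matrices in the generated subgroupoid *)

Section GroupoidInverse.
Variable G : groupoid.

Lemma ginv_unique (a b : gobj G) (g : ghom a b) (h : ghom b a) :
  gcomp h g = gidm a -> h = ginv g.
Proof.
case: G a b g h => obj hm idm comp inv compA comp1m compm1 compVm compmV /= a b g h hg.
by rewrite -[LHS]compm1 -(compmV _ _ g) compA hg comp1m.
Qed.

Lemma subgroupoid_hom_inv (S : forall a b : gobj G, ghom a b -> Prop)
    (a b : gobj G) (g : ghom a b) :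
  subgroupoid_hom S g -> subgroupoid_hom S (ginv g).
Proof.
elim=> {a b g} [a b g Sg|a b g Sg|a b c h g _ Sh _ Sg].
- exact: subgroupoid_inv.
- have <- : g = ginv (ginv g); last exact: subgroupoid_gen.
  apply: ginv_unique.
  by case: G a b g {Sg S} => obj hm idm comp inv ? ? ? ? compmV a b g; apply: compmV.
- have <- : gcomp (ginv g) (ginv h) = ginv (gcomp h g); last exact: subgroupoid_comp.
  apply: ginv_unique.
  case: G a b c h g {S Sg Sh} => obj hm idm comp inv compA comp1m ? compVm ? /= a b c h g.
  by rewrite -compA (compA _ _ _ _ (inv _ _ h)) compVm comp1m compVm.
Qed.

End GroupoidInverse.

Section GeneratedMatrices.
Variables (K : fieldType) (E : digraph) (f : vertex E -> seq (edge E)).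
Local Notation L := (lpa K E).
Local Notation V := (vertex E).
Local Notation vtx := (@lpa_vertex K E).

(** Membership in the generated subgroupoid, for matrices whose sizes are
    arbitrary rather than successors: the matrices built from lists have
    sizes such as [size s1 + size s2].  The middle size of a product has to be
    positive, because the objects of the groupoid are nonempty words. *)
Inductive gen : forall m n, m.-tuple V -> n.-tuple V -> 'M[L]_(m, n) -> Prop :=
| gen_EFP m n (s : m.-tuple V) (t : n.-tuple V) A : EFPmx f s t A -> gen s t A
| gen_inv m n (s : m.-tuple V) (t : n.-tuple V) A B :
    gen s t A -> corner_inverse vtx s t A B -> gen t s B
| gen_mul m n p (s : m.-tuple V) (t : n.-tuple V) (u : p.-tuple V) A B :
    (0 < n)%N -> gen s t A -> gen t u B -> gen s u (A *m B).

Lemma in_corner_elementary m (s : m.-tuple V) i j (y : L) :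
  in_corner vtx s s (elementary_mx vtx s i j (vtx (tnth s i) * y * vtx (tnth s j))).
Proof.
move=> a b; have [z zE] := in_corner_id (@lpa_vertexK K E) s a b.
rewrite mxE zE !mxE.
case: (altP (a =P i)) => [->|_]; case: (altP (b =P j)) => [->|_] /=;
  rewrite ?mulr1 ?mulr0 ?addr0; try by exists z.
by exists (z + y); rewrite mulrDr mulrDl.
Qed.

(** The inverse of an elementary matrix is the one with the opposite entry. *)
Lemma Emx_GL m (s : m.-tuple V) A : Emx vtx s A -> GLmx vtx s s A.
Proof.
have vK := @lpa_vertexK K E.
elim=> {A} [i j y ij||A B _ IHA _ IHB|A B _ [sA _] AB].
- pose z := vtx (tnth s i) * y * vtx (tnth s j).
  have corner_z (w : L) : w = z \/ w = - z ->
      in_corner vtx s s (elementary_mx vtx s i j w).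
    case=> ->; first exact: in_corner_elementary.
    by rewrite /z -mulNr -mulrN; apply: in_corner_elementary.
  have delta0 : delta_mx i j *m delta_mx i j = 0 :> 'M[L]_m.
    by rewrite mul_delta_mx_0 // eq_sym.
  have opp w w' : (w = z \/ w = - z) -> (w' = z \/ w' = - z) -> w + w' = 0 ->
      elementary_mx vtx s i j w *m elementary_mx vtx s i j w' = corner_id vtx s.
    move=> wz wz' ww';
        rewrite {2}/elementary_mx mulmxDr (corner_mulmx1 vK (corner_z _ wz)).
    rewrite /elementary_mx mulmxDl -scalemxAl.
    have -> : delta_mx i j *m (w' *: delta_mx i j) = 0 :> 'M[L]_m.
      apply/matrixP=> a b; rewrite !mxE big1 // => k _; rewrite !mxE.
      case: (altP (k =P i)) => [->|_]; last by rewrite mulr0 mulr0.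
      by rewrite (negPf ij) andbF mul0r.
    have -> : corner_id vtx s *m (w' *: delta_mx i j) = w' *: delta_mx i j.
      apply/matrixP=> a b; rewrite mul_diag_mx !mxE.
      case: (altP (a =P i)) => [->|_] /=; last by rewrite !mulr0.
      by case: wz' => ->; rewrite /z ?mulNr ?mulrN !mulrA vK.
    by rewrite scaler0 addr0 -addrA -scalerDl ww' scale0r addr0.
  split; first by apply: corner_z; left.
  exists (elementary_mx vtx s i j (- z)); split.
  + by apply: corner_z; right.
  + by apply: opp; rewrite ?subrr; [left|right|].
  + by apply: opp; rewrite ?addNr; [right|left|].
- exact: GLmx_id.
- exact: GLmx_mul IHA IHB.
- exact: GLmx_inv AB.
Qed.

Lemma EFPmx_GL m n (s : m.-tuple V) (t : n.-tuple V) A :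
  EFPmx f s t A -> GLmx vtx s t A.
Proof. by case=> {m n s t A} [m s A /Emx_GL //|m n s t A [] //|n s t A []]. Qed.

Lemma gen_GL m n (s : m.-tuple V) (t : n.-tuple V) A : gen s t A -> GLmx vtx s t A.
Proof.
elim=> {m n s t A} [m n s t A /EFPmx_GL //|m n s t A B _ [sA _] AB|].
  exact: GLmx_inv AB.
by move=> m n p s t u A B _ _ sA _ tB; have := GLmx_mul (@lpa_vertexK K E) sA tB.
Qed.

Definition in_subgroupoid (a b : word V)
    (A : 'M[L]_((wlen b).+1, (wlen a).+1)) : Prop :=
  exists2 g : @ghom (lpa_groupoid K E) a b,
    sval g = A & @subgroupoid_hom (lpa_groupoid K E) (@EFP K E f) a b g.

Lemma gen_subgroupoid m n (s : m.-tuple V) (t : n.-tuple V) A : gen s t A ->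
  match m, n return m.-tuple V -> n.-tuple V -> 'M[L]_(m, n) -> Prop with
  | m'.+1, n'.+1 => fun s t A => in_subgroupoid (a := Word t) (b := Word s) A
  | _, _ => fun _ _ _ => True
  end s t A.
Proof.
elim=> {m n s t A}.
- move=> m n s t A sAt; case: m n s t A sAt => [|m] [|n] s t A sAt //.
  exists (exist _ A (EFPmx_GL sAt) : @ghom (lpa_groupoid K E) (Word t) (Word s)) => //.
  exact: subgroupoid_gen.
- move=> m n s t A B gA; case: m n s t A B gA => [|m] [|n] s t A B gA //.
  case=> g gE gS AB.
  pose h : @ghom (lpa_groupoid K E) (Word s) (Word t) :=
    exist _ B (GLmx_inv (gen_GL gA).1 AB).
  exists h => //; have -> : h = ginv g; last exact: subgroupoid_hom_inv.
  apply: ginv_unique; apply: gl_hom_inj => /=.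
  by rewrite gE; have [] := AB.
- move=> m [|n] p s t u A B // _;
    case: m p s u A B => [|m] [|p] s u A B // _ [g gE gS] _ [h hE hS].
  exists (gcomp g h); first by rewrite /= gE hE.
  exact: subgroupoid_comp.
Qed.

End GeneratedMatrices.

(** * Dual bases and moves between them *)

Section States.
Variables (K : fieldType) (E : digraph) (f : vertex E -> seq (edge E)).
Hypothesis hf : out_enumeration f.
Local Notation L := (lpa K E).
Local Notation V := (vertex E).
Local Notation vtx := (@lpa_vertex K E).
Local Notation edg := (@lpa_edge K E).
Local Notation gho := (@lpa_ghost K E).
Local Notation gen := (@gen K E f).
Variables (n : nat) (t : n.+1.-tuple V).
Local Notation It := (corner_id vtx t).

(** A label v, a row a with v a = a, and a column b with b v = b.  A list of such
    triples is a [dual_basis] when the rows form a basis of the row space with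
    column labels t and the columns are dual to it; this encodes an invertible
    matrix together with its inverse as a list, whose entries can be permuted,
    deleted and replaced without casts between sizes. *)
Definition item : Type := (V * 'rV[L]_n.+1 * 'cV[L]_n.+1)%type.
Definition label (x : item) : V := x.1.1.
Definition vec (x : item) : 'rV[L]_n.+1 := x.1.2.
Definition covec (x : item) : 'cV[L]_n.+1 := x.2.

Definition orth (x y : item) : bool :=
    (vec x *m covec y == 0) && (vec y *m covec x == 0).

Definition wf_item (x : item) : Prop :=
  [/\ vtx (label x) *: vec x = vec x, covec x *m (vtx (label x))%:M = covec x &
      vec x *m covec x = (vtx (label x))%:M].

Record dual_basis (S : seq item) : Prop := DualBasis {
  dual_basis_wf_item : forall x, x \in S -> wf_item x;
  dual_basis_orth : pairwise orth S;
  dual_basis_sum : \sum_(x <- S) covec x *m vec x = It }.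

Definition labels m (X : m.-tuple item) : m.-tuple V := map_tuple label X.

(** The matrix that expresses the rows of X in terms of the rows of Y. *)
Definition gram m k (X : m.-tuple item) (Y : k.-tuple item) : 'M[L]_(m, k) :=
  \matrix_(i, j) (vec (tnth X i) *m covec (tnth Y j)) 0 0.

(** S can be carried to S' by generators: the matrix that transforms the rows of
    S' into those of S lies in the generated subgroupoid.  The relation also
    transports being a dual basis, so that chains of moves need no separate
    verification. *)
Definition reach (S S' : seq item) : Prop := dual_basis S ->
  dual_basis S' /\ gen (labels (in_tuple S)) (labels (in_tuple S'))
                  (gram (in_tuple S) (in_tuple S')).

Lemma gen_in_tuple m k (X : m.-tuple item) (Y : k.-tuple item) :
  gen (labels X) (labels Y) (gram X Y) <->
  gen (labels (in_tuple X)) (labels (in_tuple Y)) (gram (in_tuple X) (in_tuple Y)).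
Proof.
case: X Y => [X eX] [Y eY] /=; have mE := eqP eX; have kE := eqP eY; subst m k.
have -> : Tuple eX = in_tuple X by apply: val_inj.
by have -> : Tuple eY = in_tuple Y by apply: val_inj.
Qed.

Lemma orth_sym : symmetric orth.
Proof. by move=> x y; rewrite /orth andbC. Qed.

Lemma perm_pairwise (T : eqType) (r : rel T) (s s' : seq T) : symmetric r ->
  perm_eq s s' -> pairwise r s = pairwise r s'.
Proof.
move=> rC; elim: s s' => [|x s IHs] s'.
  by rewrite perm_sym => /perm_nilP->.
move=> ss'; have xs' : x \in s' by rewrite -(perm_mem ss') mem_head.
case/splitPr: xs' ss' => s1 s2 ss'.
have ss : perm_eq s (s1 ++ s2).
  by rewrite -(perm_cons x); apply: perm_trans ss' _; rewrite -cat1s perm_catCA.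
rewrite /= (IHs _ ss) !pairwise_cat /= (perm_all _ ss) all_cat.
rewrite allrel_consr.
have -> : all (r^~ x) s1 = all (r x) s1 by apply: eq_all => y; rewrite rC.
by case: (all (r x) s1); case: (all (r x) s2); case: (allrel r s1 s2);
    rewrite ?andbT ?andbF.
Qed.

Lemma dual_basis_wf_tnth m (X : m.-tuple item) i : dual_basis X -> wf_item (tnth X i).
Proof. by move=> vX; apply: (dual_basis_wf_item vX); rewrite mem_tnth. Qed.

Lemma mul11 m (A : 'M[L]_(1, m)) (B : 'M_(m, 1)) : A *m B = ((A *m B) 0 0)%:M.
Proof. exact: mx11_scalar. Qed.

Lemma orthP m (X : m.-tuple item) i j : dual_basis X -> i != j ->
  vec (tnth X i) *m covec (tnth X j) = 0.
Proof.
move=> vX ij; pose x0 := tnth X i.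
have /(pairwiseP x0) orthX := dual_basis_orth vX.
have szX (k : 'I_m) : (k < size X)%N by rewrite size_tuple.
rewrite !(tnth_nth x0) /=; case: (ltngtP i j) => [lt|lt|/val_inj eq].
- by have /andP[/eqP] := orthX i j (szX i) (szX j) lt.
- by have /andP[_ /eqP] := orthX j i (szX j) (szX i) lt.
- by rewrite eq eqxx in ij.
Qed.

Lemma gram_self m (X : m.-tuple item) : dual_basis X ->
    gram X X = corner_id vtx (labels X).
Proof.
move=> vX; apply/matrixP=> i j; rewrite mxE [RHS]mxE [in RHS]mxE tnth_map.
case: (altP (i =P j)) => [->|ij].
  by have [_ _ ->] := dual_basis_wf_tnth j vX; rewrite mxE eqxx.
by rewrite orthP // mxE mulr0n.
Qed.

Lemma dual_basis_covec m (X : m.-tuple item) i : dual_basis X ->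
    It *m covec (tnth X i) = covec (tnth X i).
Proof.
move=> vX; rewrite -(dual_basis_sum vX) mulmx_suml big_tuple (bigD1 i) //= big1 => [|j ji].
  by have [_ cv dg] := dual_basis_wf_tnth i vX; rewrite -mulmxA dg cv addr0.
by rewrite -mulmxA orthP // mulmx0.
Qed.

Lemma dual_basis_vec m (X : m.-tuple item) i : dual_basis X ->
    vec (tnth X i) *m It = vec (tnth X i).
Proof.
move=> vX; rewrite -(dual_basis_sum vX) mulmx_sumr big_tuple (bigD1 i) //= big1 => [|j ji].
  by have [vr _ dg] := dual_basis_wf_tnth i vX;
      rewrite mulmxA dg mul_scalar_mx vr addr0.
by rewrite mulmxA orthP ?mul0mx // eq_sym.
Qed.

(** Inserting the identity, written as the sum of the b_y a_y for y in Y. *)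
Lemma gramM m k l (X : m.-tuple item) (Y : k.-tuple item) (Z : l.-tuple item) :
  dual_basis Y -> dual_basis Z -> gram X Y *m gram Y Z = gram X Z.
Proof.
move=> vY vZ; apply/matrixP=> i j; rewrite mxE [RHS]mxE.
transitivity ((vec (tnth X i) *m (\sum_(y <- Y) covec y *m vec y) *m covec (tnth Z j)) 0 0).
  rewrite big_tuple mulmx_sumr mulmx_suml summxE.
  apply: eq_bigr => h _; rewrite mulmxA -mulmxA [RHS]mxE big_ord1.
  by congr (_ * _); rewrite mxE.
by rewrite (dual_basis_sum vY) -mulmxA dual_basis_covec.
Qed.

Lemma gram_corner m k (X : m.-tuple item) (Y : k.-tuple item) :
  dual_basis X -> dual_basis Y -> in_corner vtx (labels X) (labels Y) (gram X Y).
Proof.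
move=> vX vY i j; exists (gram X Y i j).
rewrite !tnth_map mxE; have [vr _ _] := dual_basis_wf_tnth i vX.
have [_ cv _] := dual_basis_wf_tnth j vY.
rewrite -{1}vr -{1}cv -scalemxAl mulmxA (mul11 (vec _) (covec _)).
by rewrite -scalar_mxM !mxE !eqxx !mulr1n mulrA.
Qed.

Lemma gram_inverse m k (X : m.-tuple item) (Y : k.-tuple item) :
  dual_basis X -> dual_basis Y ->
  corner_inverse vtx (labels X) (labels Y) (gram X Y) (gram Y X).
Proof.
by move=> vX vY; split; [exact: gram_corner|rewrite gramM ?gram_self..].
Qed.

Lemma gram_GL m k (X : m.-tuple item) (Y : k.-tuple item) :
  dual_basis X -> dual_basis Y -> GLmx vtx (labels X) (labels Y) (gram X Y).
Proof.
move=> vX vY; split; first exact: gram_corner.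
by eexists; apply: gram_inverse.
Qed.

(** The identity matrix is nonzero since vertices are nonzero in L. *)
Lemma dual_basis_size S : dual_basis S -> (0 < size S)%N.
Proof.
move=> vS; case: S vS => // vS; have /matrixP/(_ ord0 ord0) := dual_basis_sum vS.
rewrite big_nil !mxE eqxx mulr1n => /esym/eqP.
by rewrite (negPf (vtx_neq0 _ _)).
Qed.

Lemma reach_refl S : reach S S.
Proof.
move=> vS; split=> //; rewrite gram_self //.
by apply/gen_EFP/EFPmx_E/Emx_id.
Qed.

Lemma reach_trans S2 S1 S3 : reach S1 S2 -> reach S2 S3 -> reach S1 S3.
Proof.
move=> r12 r23 v1; have [v2 g12] := r12 v1; have [v3 g23] := r23 v2.
split=> //; rewrite -(gramM _ (Y := in_tuple S2) (Z := in_tuple S3)) //.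
exact: gen_mul (dual_basis_size v2) g12 g23.
Qed.

Lemma reach_perm S S' : perm_eq S S' -> reach S S'.
Proof.
move=> pS vS.
have vS' : dual_basis S'.
  split=> [x||].
  - by rewrite -(perm_mem pS); apply: (dual_basis_wf_item vS).
  - by rewrite -(perm_pairwise orth_sym pS); apply: (dual_basis_orth vS).
  - by rewrite -(perm_big _ pS); apply: (dual_basis_sum vS).
split=> //; move: pS; rewrite perm_sym => /(tuple_permP (t := in_tuple S))[p S'E].
pose Y := [tuple tnth (in_tuple S) (p i) | i < size S].
rewrite {}S'E in vS' *.
apply: (gen_in_tuple (in_tuple S) Y).1.
apply/gen_EFP/EFPmx_P; split; first exact: gram_GL.
exists (p^-1)%g, (fun=> 1); split=> [i|i|i j].
- by rewrite !tnth_map tnth_ord_tuple permKV.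
- exact: oner_neq0.
rewrite mxE tnth_map tnth_ord_tuple scale1r; case: (altP (j =P _)) => [->|ij].
  rewrite permKV tnth_map; have [_ _ ->] := dual_basis_wf_tnth (X := in_tuple S) i vS.
  by rewrite mxE eqxx.
rewrite (orthP (X := in_tuple S)) ?mxE //; apply: contra ij => /eqP->.
by rewrite permK.
Qed.

Lemma reach_scale x S (k : K) : k != 0 ->
  reach (x :: S) ((label x, (k *: vtx (label x)) *: vec x,
                   covec x *m (k^-1 *: vtx (label x))%:M) :: S).
Proof.
pose x' : item := (label x, (k *: vtx (label x)) *: vec x,
    covec x *m (k^-1 *: vtx (label x))%:M).
rewrite -/x' => k0 vS.
have [vr cv dg] : wf_item x by apply: (dual_basis_wf_item vS); rewrite mem_head.
have kk : (k *: vtx (label x)) * (k^-1 *: vtx (label x)) = vtx (label x).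
  by rewrite -lpa_scalerAr -lpa_scalerAl lpa_vertexK scalerA mulVf // scale1r.
have kk' : (k^-1 *: vtx (label x)) * (k *: vtx (label x)) = vtx (label x).
  by rewrite -lpa_scalerAr -lpa_scalerAl lpa_vertexK scalerA mulfV // scale1r.
have lE : label x' = label x by [].
have rE : vec x' = (k *: vtx (label x)) *: vec x by [].
have cE : covec x' = covec x *m (k^-1 *: vtx (label x))%:M by [].
have vS' : dual_basis (x' :: S).
  split=> [y||].
  - rewrite inE => /predU1P[->|yS]; last by apply: (dual_basis_wf_item vS);
      rewrite inE yS orbT.
    split; rewrite ?lE ?rE ?cE.
    + by rewrite scalerA -lpa_scalerAr lpa_vertexK.
    + by rewrite -mulmxA -scalar_mxM -lpa_scalerAl lpa_vertexK.
    + rewrite mulmxA -scalemxAl dg -mul_scalar_mx -!scalar_mxM.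
      by rewrite -mulrA -lpa_scalerAr lpa_vertexK kk.
  - have /= /andP[xS ->] := dual_basis_orth vS; rewrite andbT.
    apply: sub_all xS => y /andP[/eqP xy /eqP yx]; apply/andP.
    by rewrite rE cE -scalemxAl xy mulmxA yx scaler0 mul0mx.
  - rewrite -(dual_basis_sum vS) !big_cons rE cE; congr (_ + _).
    by rewrite -mulmxA mul_scalar_mx scalerA kk' vr.
split=> //.
apply: gen_EFP; apply: EFPmx_P; split.
  exact: (gram_GL (X := in_tuple (x :: S)) (Y := in_tuple (x' :: S))).
exists 1%g, (fun i => if i == 0%N :> nat then k^-1 else 1); split=> [i|i|i j].
- by rewrite perm1 !tnth_map !(tnth_nth x) /=; case: i => [[|i] ?].
- by case: ifP => _; rewrite ?invr_eq0 ?oner_neq0.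
rewrite perm1 mxE; have := gram_self (X := in_tuple (x :: S)) vS.
move/matrixP/(_ i j); rewrite mxE [in RHS]mxE [in RHS]mxE tnth_map => gE.
have -> : covec (tnth (in_tuple (x' :: S)) j) = covec (tnth (in_tuple (x :: S)) j) *m
   ((if j == 0%N :> nat then k^-1 else 1) *: vtx (label (tnth (in_tuple (x :: S)) j)))%:M.
  rewrite !(tnth_nth x) /=; case: j {gE} => [[|j] ltj] //=.
  have [_ cvj _] : wf_item (nth x S j).
    by apply: (dual_basis_wf_item vS); rewrite inE mem_nth ?orbT.
  by rewrite scale1r cvj.
rewrite mulmxA (mul11 (vec _) (covec _)) -scalar_mxM mxE eqxx mulr1n gE eq_sym.
case: (altP (j =P i)) => [->|ij]; last by rewrite mulr0n mul0r.
by rewrite mulr1n -lpa_scalerAr lpa_vertexK.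
Qed.

Lemma dual_basis_consP x y S :
  dual_basis (x :: y :: S) <->
  [/\ wf_item x, wf_item y, forall z, z \in S -> wf_item z,
      [&& orth x y, all (orth x) S, all (orth y) S & pairwise orth S] &
      covec x *m vec x + (covec y *m vec y + \sum_(z <- S) covec z *m vec z) = It].
Proof.
split=> [[wfS /= oS sS]|[wx wy wS oS sS]].
  split; last by rewrite -sS !big_cons.
  - by apply: wfS; rewrite mem_head.
  - by apply: wfS; rewrite !inE eqxx orbT.
  - by move=> z zS; apply: wfS; rewrite !inE zS !orbT.
  - by move: oS => /andP[/andP[-> ->]].
split; last by rewrite !big_cons.
  move=> z; rewrite !inE => /predU1P[->//|/predU1P[->//|]]; exact: wS.
by move: oS => /=; rewrite andbA.
Qed.

(** The elementary matrices.  A multiple of one row is added to another row,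
    and the dual columns change contragrediently. *)
Lemma reach_elem x y S (xi : L) : vtx (label x) * xi * vtx (label y) = xi ->
  reach (x :: y :: S)
    ((label x, vec x + xi *: vec y, covec x) :: (label y, vec y,
        covec y - covec x *m xi%:M) :: S).
Proof.
pose x' : item := (label x, vec x + xi *: vec y, covec x).
pose y' : item := (label y, vec y, covec y - covec x *m xi%:M).
rewrite -/x' -/y' => xiE vS.
have lxE : label x' = label x by [].
have rxE : vec x' = vec x + xi *: vec y by [].
have cxE : covec x' = covec x by [].
have lyE : label y' = label y by [].
have ryE : vec y' = vec y by [].
have cyE : covec y' = covec y - covec x *m xi%:M by [].
have [[vx cx dx] [vy cy dy] wS /and4P[/andP[/eqP xy /eqP yx] oxS oyS oS] sS] :=
  (dual_basis_consP x y S).1 vS.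
have vxi : vtx (label x) * xi = xi by rewrite -xiE !mulrA lpa_vertexK.
have xiv : xi * vtx (label y) = xi by rewrite -xiE -!mulrA lpa_vertexK.
have vS' : dual_basis (x' :: y' :: S).
  apply/dual_basis_consP; split=> //.
  - split; rewrite ?lxE ?rxE ?cxE //.
      by rewrite scalerDr scalerA vx vxi.
    by rewrite mulmxDl dx -scalemxAl yx scaler0 addr0.
  - split; rewrite ?lyE ?ryE ?cyE //.
      by rewrite mulmxBl cy -mulmxA -scalar_mxM xiv.
    by rewrite mulmxBr dy mulmxA yx mul0mx subr0.
  - apply/and4P; split=> //.
    + rewrite /orth rxE cxE ryE cyE yx eqxx andbT mulmxBr !mulmxDl !mulmxA.
      rewrite -!scalemxAl xy yx dx dy mul0mx scaler0 addr0 add0r -scalar_mxM vxi.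
      by rewrite -mul_scalar_mx -scalar_mxM xiv subrr.
    + apply/allP=> z zS; rewrite /orth rxE cxE mulmxDl -scalemxAl.
      have /andP[/eqP-> ->] := allP oxS _ zS; have /andP[/eqP-> _] := allP oyS _ zS.
      by rewrite scaler0 addr0 eqxx.
    + apply/allP=> z zS; rewrite /orth ryE cyE mulmxBr mulmxA.
      have /andP[_ /eqP->] := allP oxS _ zS; have /andP[-> /eqP->] := allP oyS _ zS.
      by rewrite mul0mx subr0 eqxx.
  - rewrite -sS rxE cxE ryE cyE mulmxDr mulmxBl -mulmxA mul_scalar_mx.
    rewrite -!addrA; congr (_ + _); rewrite addrCA; congr (_ + _).
    by rewrite addrA subrr add0r.
split=> //.
pose X := in_tuple (x :: y :: S); pose X' : (size S).+2.-tuple item :=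
    in_tuple (x' :: y' :: S).
have lE : labels X' = labels X by apply: val_inj.
rewrite -[labels (in_tuple (x' :: _))]/(labels X') lE.
apply: gen_EFP; apply: EFPmx_E.
have := @Emx_elementary _ _ vtx _ (labels X) ord0 (lift ord0 ord0) (- xi) isT.
have -> : vtx (tnth (labels X) ord0) * - xi * vtx (tnth (labels X) (lift ord0 ord0)) = - xi.
  by rewrite !tnth_map !(tnth_nth x) /= mulrN mulNr xiE.
congr (Emx _ _ _); rewrite /elementary_mx -(gram_self (X := X)) //.
have grE m k (Y : m.-tuple item) (Z : k.-tuple item) i j :
  gram Y Z i j = (vec (tnth Y i) *m covec (tnth Z j)) 0 0 by rewrite mxE.
apply/esym/matrixP=> i j; rewrite [RHS]mxE !grE [X in _ + X]mxE [delta_mx _ _ _ _]mxE.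
have -> : covec (tnth X' j) = covec (tnth X j) -
    (if j == lift ord0 ord0 then covec (tnth X ord0) *m xi%:M else 0).
  rewrite !(tnth_nth x) /=; case: j => [[|[|j]] ltj] //=; rewrite ?subr0 //.
rewrite mulmxBr; case: eqP => _; last by rewrite andbF mulr0 addr0 mulmx0 subr0.
rewrite mulmxA andbT [LHS]mxE; congr (_ + _).
case: (altP (i =P ord0)) => [->|i0]; last first.
  by rewrite (orthP (X := X)) // mul0mx !mxE oppr0 mulr0.
rewrite (tnth_nth x) /= dx -scalar_mxM vxi !mxE mulr1.
by [].
Qed.

Lemma Fdiag_corner_id m (s : m.-tuple V) : Fdiag f (corner_id vtx s).
Proof.
elim: m s => [|m IHm] s.
  have -> : corner_id vtx s = 0 by apply/matrixP=> [] [].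
  exact: Fdiag_nil.
have -> : corner_id vtx s =
    block_mx (const_mx (vtx (thead s))) 0 0 (corner_id vtx [tuple of behead s])
    :> 'M[L]_(1 + m, 1 + m).
  apply/matrixP=> i j; rewrite [LHS]mxE [in LHS]mxE.
  rewrite -[i]splitK -[j]splitK; case: (split i) => i'; case: (split j) => j' /=.
  - rewrite block_mxEul mxE !ord1 eqxx mulr1n /thead; congr (vtx (tnth s _)).
    exact: val_inj.
  - by rewrite block_mxEur mxE -val_eqE /= ord1.
  - by rewrite block_mxEdl mxE -val_eqE /= ord1.
  - rewrite block_mxEdr [RHS]mxE [in RHS]mxE tnth_behead -val_eqE /= eqn_add2l.
    congr (vtx (tnth s _) *+ _).
    by apply: val_inj => /=; rewrite inordK ?ltnS ?ltn_ord.
exact: Fdiag_cons (Fblock_vertex K f (thead s)) (IHm [tuple of behead s]).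
Qed.

(** The move given by the row (f_1, ..., f_m) of the edges leaving the label. *)
Definition expand (x : item) : seq item :=
  [seq (tgt e, gho e *: vec x, covec x *m (edg e)%:M) | e <- f (label x)].

(** Relation (iii) makes the new rows and columns dual to each other, relation
    (iv) makes them span the same space.  The transforming matrix is the block
    diagonal matrix with the row of edges leaving the label and an identity. *)
Lemma reach_expand x S : regular (label x) -> reach (x :: S) (expand x ++ S).
Proof.
move=> vreg vS; have [fv_uniq mem_fv] : uniq (f (label x)) /\
    (f (label x) =i out_edges (label x)).
  split; first by rewrite (perm_uniq (hf _)) enum_uniq.
  by move=> e; rewrite (perm_mem (hf _)) mem_enum.
have srcE e : e \in f (label x) -> src e = label x by rewrite mem_fv inE => /eqP.
have [vx cx dx] : wf_item x by apply: (dual_basis_wf_item vS); rewrite mem_head.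
have vdg e : e \in f (label x) -> vtx (label x) * edg e = edg e.
  by move=> /srcE <-; rewrite vtx_edge eqxx.
have gv e : e \in f (label x) -> gho e * vtx (label x) = gho e.
  by move=> /srcE <-; rewrite ghost_vtx eqxx.
have /= /andP[xS oS] := dual_basis_orth vS.
have vS' : dual_basis (expand x ++ S).
  split.
  - move=> y; rewrite mem_cat => /orP[/mapP[e ev ->]|yS]; last first.
      by apply: (dual_basis_wf_item vS); rewrite inE yS orbT.
    split; rewrite /label /vec /covec /=.
    + by rewrite scalerA tgt_ghost.
    + by rewrite -mulmxA -scalar_mxM edge_tgt.
    + rewrite -/(vec x) -/(covec x) -scalemxAl mulmxA dx -mul_scalar_mx -!scalar_mxM.
      by rewrite vdg // ghost_edge eqxx.
  - rewrite pairwise_cat oS andbT; apply/andP; split.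
      apply/allrelP=> _ z /mapP[e ev ->] zS; have /andP[/eqP xz /eqP zx] :=
          allP xS _ zS.
      rewrite /orth {1}/vec {2}/covec /= -scalemxAl xz mulmxA zx scaler0 mul0mx.
      by rewrite eqxx.
    rewrite pairwise_map; have := fv_uniq; rewrite uniq_pairwise.
    apply: (sub_in_pairwise (P := mem (f (label x)))); last by apply/allP.
    have orth0 e e' : e \in f (label x) -> e' \in f (label x) -> e != e' ->
        (gho e *: vec x) *m (covec x *m (edg e')%:M) = 0.
      move=> ev ev' ee'; rewrite -scalemxAl mulmxA dx -mul_scalar_mx -!scalar_mxM.
      by rewrite vdg // ghost_edge (negPf ee') raddf0.
    move=> e e' ev ev' /= ee'; rewrite /orth /vec /covec /= !orth0 ?eqxx //.
    by rewrite eq_sym.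
  - rewrite -(dual_basis_sum vS) big_cat big_cons; congr (_ + _); rewrite big_map.
    have rxE : vec x = \sum_(e <- f (label x)) (edg e * gho e) *: vec x.
      by rewrite -scaler_suml (perm_big _ (hf _)) (sum_edge_ghost K vreg) vx.
    rewrite [in RHS]rxE mulmx_sumr; apply: eq_bigr => e _; rewrite /vec /covec /=.
    by rewrite -mulmxA mul_scalar_mx scalerA.
split=> //.
pose Y := cat_tuple (map_tuple (fun e => (tgt e, gho e *: vec x,
    covec x *m (edg e)%:M) : item)
  (in_tuple (f (label x)))) (in_tuple S).
apply: (gen_in_tuple (in_tuple (x :: S)) Y).1.
apply: gen_EFP; apply: EFPmx_F; split; first exact: (gram_GL (X :=
    in_tuple (x :: S)) (Y := Y)).
have -> : gram (in_tuple (x :: S)) Y =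
    block_mx (\row_j edg (tnth (in_tuple (f (label x))) j)) 0 0 (corner_id vtx (labels (in_tuple S)))
    :> 'M[L]_(1 + size S, _).
  have tn1 (i : 'I_1) : tnth (in_tuple (x :: S)) (lshift (size S) i) = x.
    by rewrite (tnth_nth x) ord1.
  have tnS (i : 'I_(size S)) : tnth (in_tuple (x :: S)) (rshift 1 i) = tnth (in_tuple S) i.
    by rewrite !(tnth_nth x).
  apply/matrixP=> i j; rewrite -[i]splitK -[j]splitK.
  case: (split i) => i'; case: (split j) => j' /=; rewrite [LHS]mxE ?tn1 ?tnS.
  - rewrite block_mxEul [RHS]mxE /Y tnth_lshift tnth_map /covec /= mulmxA -/(covec x) dx.
    by rewrite -scalar_mxM vdg ?mem_tnth // mxE eqxx mulr1n.
  - rewrite block_mxEur [RHS]mxE /Y tnth_rshift.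
    by have /andP[/eqP-> _] := allP xS _ (mem_tnth j' (in_tuple S)); rewrite mxE.
  - rewrite block_mxEdl [RHS]mxE /Y tnth_lshift tnth_map /covec /= mulmxA -/(covec x).
    by have /andP[_ /eqP->] := allP xS _ (mem_tnth i' (in_tuple S)); rewrite mul0mx mxE.
  - rewrite block_mxEdr /Y tnth_rshift.
    have /matrixP/(_ (rshift 1 i') (rshift 1 j')) := gram_self (X :=
        in_tuple (x :: S)) vS.
    rewrite mxE !tnS => ->; rewrite !mxE !tnth_map tnS; congr (_ *+ _).
exact: Fdiag_cons (Fblock_row K f vreg) (Fdiag_corner_id (labels (in_tuple S))).
Qed.

End States.

(** * Pivoting *)

Section DerivedMoves.
Variables (K : fieldType) (E : digraph) (f : vertex E -> seq (edge E)).
Local Notation L := (lpa K E).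
Local Notation V := (vertex E).
Local Notation vtx := (@lpa_vertex K E).
Variables (n : nat) (t : n.+1.-tuple V).
Local Notation item := (item K E n).
Local Notation dual_basis := (@dual_basis K E n t).
Local Notation reach := (@reach K E f n t).

Lemma reach_valid S S' : dual_basis S -> reach S S' -> dual_basis S'.
Proof. by move=> vS /(_ vS)[]. Qed.

Lemma item_eq (x y : item) : label x = label y -> vec x = vec y ->
    covec x = covec y -> x = y.
Proof. by case: x y => [[a b] c] [[a' b'] c'] /= ;
    rewrite /label /vec /covec /= => -> -> ->. Qed.

Lemma reach_pivot (A : Type) (it : A -> item) (xi : A -> L) (x : item) (Z : seq A) T :
  (forall z, vtx (label x) * xi z * vtx (label (it z)) = xi z) ->
  reach (x :: map it Z ++ T)
    ((label x, vec x + \sum_(z <- Z) xi z *: vec (it z), covec x) ::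
     [seq (label (it z), vec (it z),
         covec (it z) - covec x *m (xi z)%:M) | z <- Z] ++ T).
Proof.
elim: Z x T => [|z Z IHZ] x T xiP.
  rewrite big_nil /=; have -> : (label x, vec x + 0, covec x) = x;
      last exact: reach_refl.
  by apply: item_eq => //; rewrite /vec /= addr0.
pose x1 : item := (label x, vec x + xi z *: vec (it z), covec x).
pose z1 : item := (label (it z), vec (it z), covec (it z) - covec x *m (xi z)%:M).
apply: (reach_trans (S2 := x1 :: z1 :: (map it Z ++ T))).
  exact: reach_elem.
apply: (reach_trans (S2 := x1 :: map it Z ++ (z1 :: T))).
  by apply: reach_perm; rewrite perm_cons -cat1s perm_catCA.
apply: reach_trans (IHZ x1 _ xiP) _; apply: reach_perm; rewrite /= big_cons.
have -> : vec x1 + \sum_(j <- Z) xi j *: vec (it j) =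
   vec x + (xi z *: vec (it z) + \sum_(j <- Z) xi j *: vec (it j)) by rewrite addrA.
by rewrite perm_cons -cat1s perm_catCA.
Qed.

(** The new dual column of x is left unspecified: in the elimination it is
    recovered at the end from the rows, which determine it. *)
Lemma reach_clear (A : Type) (it : A -> item) (xi : A -> L) (x : item) (Z : seq A) T :
  (forall z, vtx (label (it z)) * xi z * vtx (label x) = xi z) ->
  exists c, reach (x :: map it Z ++ T)
    ((label x, vec x, c) ::
     [seq (label (it z), vec (it z) + xi z *: vec x, covec (it z)) | z <- Z] ++ T).
Proof.
elim: Z x T => [|z Z IHZ] x T xiP.
  by exists (covec x); case: x {xiP} => [[? ?] ?]; apply: reach_refl.
pose x1 : item := (label x, vec x, covec x - covec (it z) *m (xi z)%:M).
pose z1 : item := (label (it z), vec (it z) + xi z *: vec x, covec (it z)).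
have [c rc] := IHZ x1 (z1 :: T) xiP; exists c.
apply: (reach_trans (S2 := it z :: x :: (map it Z ++ T))).
  by apply: reach_perm; rewrite /= -cat1s -(cat1s _ (_ ++ _)) perm_catCA.
apply: (reach_trans (S2 := z1 :: x1 :: (map it Z ++ T))); first exact: reach_elem.
apply: (reach_trans (S2 := x1 :: map it Z ++ (z1 :: T))).
  apply: reach_perm; rewrite -cat1s -(cat1s x1 (_ ++ _)) perm_catCA /= perm_cons.
  by rewrite -cat1s perm_catCA.
apply: reach_trans rc _; apply: reach_perm.
by rewrite perm_cons /= -cat1s perm_catCA.
Qed.

(** A scaling followed by a pivot step.  The new dual columns are explicit because
    the reductions below have to bound their levels. *)
Lemma reach_replace (I : finType) (s : I -> item) i0 (xi : I -> L) (c : K) :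
  c != 0 -> xi i0 = c *: vtx (label (s i0)) ->
  (forall i, vtx (label (s i0)) * xi i * vtx (label (s i)) = xi i) ->
  (forall i, vtx (label (s i)) *: vec (s i) = vec (s i)) ->
  exists x, [/\ label x = label (s i0), vec x = \sum_i xi i *: vec (s i),
    covec x = covec (s i0) *m (c^-1 *: vtx (label (s i0)))%:M &
    reach (map s (enum I))
      (x :: [seq (label (s i), vec (s i),
          covec (s i) - covec x *m (xi i)%:M) | i <- rem i0 (enum I)])].
Proof.
move=> c0 xi0 xiP wfs.
pose x0 : item := (label (s i0), (c *: vtx (label (s i0))) *: vec (s i0),
                   covec (s i0) *m (c^-1 *: vtx (label (s i0)))%:M).
exists (label x0, vec x0 + \sum_(i <- rem i0 (enum I)) xi i *: vec (s i), covec x0);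
    split=> //.
  have -> : vec x0 = xi i0 *: vec (s i0) by rewrite xi0.
  by rewrite -[RHS]big_enum /= (perm_big _ (perm_to_rem (mem_enum I i0))) big_cons.
apply: (reach_trans (S2 := s i0 :: map s (rem i0 (enum I)))).
  apply: reach_perm; rewrite -map_cons; apply: perm_map.
  by apply: perm_to_rem; rewrite mem_enum.
apply: (reach_trans (S2 := x0 :: map s (rem i0 (enum I)))); first exact: reach_scale.
by have := @reach_pivot _ s xi x0 (rem i0 (enum I)) [::] xiP; rewrite !cats0.
Qed.

End DerivedMoves.

(** * Gauss-Jordan elimination *)

Lemma uniq_map_inj (T T' : eqType) (g : T -> T') (s : seq T) :
  uniq (map g s) -> {in s &, injective g}.
Proof.
elim: s => [|x s IHs] //= /andP[gx us] y z; rewrite !inE.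
case/predU1P=> [->|ys] /predU1P[->|zs] // gyz; last exact: IHs gyz.
  by rewrite gyz map_f in gx.
by rewrite -gyz map_f in gx.
Qed.

Section Gauss.
Variables (K : fieldType) (E : digraph) (f : vertex E -> seq (edge E)).
Local Notation L := (lpa K E).
Local Notation V := (vertex E).
Local Notation vtx := (@lpa_vertex K E).
Variables (n : nat) (t : n.+1.-tuple V).
Local Notation It := (corner_id vtx t).
Local Notation item := (item K E n).
Local Notation dual_basis := (@dual_basis K E n t).
Local Notation reach := (@reach K E f n t).

(** The standard basis: the target of all reductions. *)
Definition id_item (j : 'I_n.+1) : item :=
  (tnth t j, vtx (tnth t j) *: delta_mx 0 j, delta_mx j 0 *m (vtx (tnth t j))%:M).

Definition id_state : seq item := map id_item (enum 'I_n.+1).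

Lemma ItE i j : It i j = if i == j then vtx (tnth t i) else 0.
Proof.
by rewrite /corner_id !mxE; case: eqP => [->|_]; rewrite ?mulr1n ?mulr0n.
Qed.

Lemma dual_basis_mem_vec S x : dual_basis S -> x \in S -> vec x *m It = vec x.
Proof. by move=> vS /(tnthP (in_tuple S))[i ->]; apply: dual_basis_vec. Qed.

Lemma dual_basis_mem_covec S x : dual_basis S -> x \in S -> It *m covec x = covec x.
Proof. by move=> vS /(tnthP (in_tuple S))[i ->]; apply: dual_basis_covec. Qed.

Lemma vec_entry S x j : dual_basis S -> x \in S ->
  vtx (label x) * vec x 0 j * vtx (tnth t j) = vec x 0 j.
Proof.
move=> vS xS; have [vx _ _] := dual_basis_wf_item vS xS.
have := dual_basis_mem_vec vS xS => /matrixP/(_ 0 j); rewrite mul_mx_diag !mxE => xj.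
move/matrixP/(_ 0 j): vx; rewrite mxE => vxj.
by rewrite vxj xj.
Qed.

Lemma vec_mulIt S x j : dual_basis S -> x \in S ->
    vec x 0 j * vtx (tnth t j) = vec x 0 j.
Proof. by move=> vS xS; rewrite -(vec_entry j vS xS) -!mulrA lpa_vertexK. Qed.

Lemma vec_vl S x j : dual_basis S -> x \in S -> vtx (label x) * vec x 0 j = vec x 0 j.
Proof. by move=> vS xS; rewrite -(vec_entry j vS xS) !mulrA lpa_vertexK. Qed.

Lemma covec_vr S x j : dual_basis S -> x \in S ->
    covec x j 0 * vtx (label x) = covec x j 0.
Proof.
move=> vS xS; have [_ /matrixP/(_ j 0) cx _] := dual_basis_wf_item vS xS.
by move: cx; rewrite mxE big_ord1 [in X in _ * X]mxE eqxx mulr1n.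
Qed.

Lemma dual_basis_vec_neq0 S x : dual_basis S -> x \in S -> vec x != 0.
Proof.
move=> vS xS; have [_ _ /matrixP/(_ 0 0)] := dual_basis_wf_item vS xS.
rewrite [RHS]mxE eqxx mulr1n => xx; apply/eqP => x0.
by have := vtx_neq0 K (label x); rewrite -xx x0 mul0mx mxE eqxx.
Qed.

Lemma dual_basis_sumE S i j : dual_basis S ->
  \sum_(x <- S) covec x i 0 * vec x 0 j = if i == j then vtx (tnth t i) else 0.
Proof.
move=> vS; rewrite -ItE -(dual_basis_sum vS) summxE; apply: eq_bigr => x _.
by rewrite mxE big_ord1.
Qed.

Lemma dual_basis_mem_orth S x y : dual_basis S -> x \in S -> y \in S -> x != y ->
  vec x *m covec y = 0.
Proof.
move=> vS /(tnthP (in_tuple S))[i ->] /(tnthP (in_tuple S))[j ->] xy.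
by apply: (orthP (X := in_tuple S) vS); apply: contraNN xy => /eqP->.
Qed.

Lemma vec_id i j : vec (id_item i) 0 j = if i == j then vtx (tnth t i) else 0.
Proof.
by rewrite !mxE eqxx /= eq_sym; case: eqP => _; rewrite ?mulr1 ?mulr0.
Qed.

(** Dual columns are determined by the rows: once the rows are the standard ones,
    so are the columns. *)
Lemma id_item_of_vec S x j : dual_basis S ->
  (forall i, exists2 y, y \in S & vec y = vec (id_item i)) ->
  x \in S -> label x = tnth t j -> vec x = vec (id_item j) -> x = id_item j.
Proof.
move=> vS allS xS lx rx; apply: item_eq => //.
apply/matrixP=> i k; rewrite ord1 {k}.
have -> : covec (id_item j) i 0 = It i j.
  rewrite mxE big_ord1 ItE !mxE !eqxx andbT mulr1n.
  by case: eqP => [->|_]; rewrite ?mul1r ?mul0r.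
have [y yS ry] := allS i.
have /matrixP/(_ i 0) <- := dual_basis_mem_covec vS xS.
rewrite mul_diag_mx !mxE.
have -> : vtx (tnth t i) * covec x i 0 = (vec y *m covec x) 0 0.
  rewrite mxE (bigD1 i) //= big1 => [|k ki].
    by rewrite ry vec_id eqxx addr0.
  by rewrite ry vec_id eq_sym (negPf ki) mul0r.
case: (altP (i =P j)) => [ij|ij].
  by have [_ _] := dual_basis_wf_item vS xS; rewrite ry ij -rx => ->;
      rewrite mxE eqxx lx.
rewrite (dual_basis_mem_orth vS yS xS) ?mxE ?mulr0n //; apply: contraNneq ij => yx.
move: ry; rewrite yx rx => /matrixP/(_ 0 i); rewrite !vec_id eqxx eq_sym.
by case: eqP => // _ /esym/eqP; rewrite (negPf (vtx_neq0 _ _)).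
Qed.

(** The intermediate state of the elimination: D holds the pivot rows, each with
    its pivot column, and the pivot columns vanish in R.  No order is imposed on
    the pivot columns; a final permutation restores it. *)
Definition gauss_state (D : seq (item * 'I_n.+1)) (R : seq item) : Prop :=
  [/\ uniq (map snd D),
      forall z, z \in D -> label z.1 = tnth t z.2,
      forall z j, z \in D -> j \in map snd D ->
        vec z.1 0 j = if z.2 == j then vtx (tnth t j) else 0 &
      forall x j, x \in R -> j \in map snd D -> vec x 0 j = 0].

Definition const_row (x : item) : Prop := forall j, deg_lt 1 (vec x 0 j).

Lemma gauss_done D R : dual_basis (map fst D ++ R) -> gauss_state D R ->
  (forall j, j \in map snd D) -> reach (map fst D ++ R) id_state.
Proof.
move=> vS [uD lD rD rR] allD.
have R0 : R = [::].
  case: R vS rR => // x R vS rR; have xS : x \in map fst D ++ x :: R.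
    by rewrite mem_cat mem_head orbT.
  case/eqP: (dual_basis_vec_neq0 vS xS); apply/rowP=> j.
  by rewrite (rR x) ?mem_head // mxE.
rewrite {}R0 cats0 in vS rR *.
have rDj z : z \in D -> vec z.1 = vec (id_item z.2).
  by move=> zD; apply/rowP=> j; rewrite rD // vec_id; case: eqP => [->|].
have idD : map fst D = map id_item (map snd D).
  rewrite -map_comp; apply/eq_in_map => z zD /=.
  apply: (id_item_of_vec vS) => [i|||]; [|exact: map_f|exact: lD|exact: rDj].
  have /mapP[y yD ->] := allD i; exists y.1; [exact: map_f|exact: rDj].
rewrite idD; apply/reach_perm/perm_map/uniq_perm => //; first exact: enum_uniq.
by move=> j; rewrite allD mem_enum.
Qed.

(** If column j vanished on R, then the pivot columns would force the dual columns
    of the pivot rows to vanish at j, and the j-th diagonal entry of the sum of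
    the b_x a_x would be zero instead of a vertex. *)
Lemma gauss_pivot D R j : dual_basis (map fst D ++ R) -> gauss_state D R ->
  j \notin map snd D -> exists2 x, x \in R & vec x 0 j != 0.
Proof.
move=> vS [uD lD rD rR] jD; apply: contrapT => no.
have R0 x : x \in R -> vec x 0 j = 0.
  by move=> xR; apply: contrapT => /eqP xj; apply: no; exists x.
have clD z : z \in D -> covec z.1 j 0 = 0.
  move=> zD; have zS : z.1 \in map fst D ++ R by rewrite mem_cat map_f.
  have zD2 : z.2 \in map snd D by apply: map_f.
  have := dual_basis_sumE j z.2 vS; case: eqP => [jz|_]; first by rewrite jz zD2 in jD.
  rewrite big_cat /= big_map [X in _ + X]big1_seq ?addr0 => [|x /= xR]; last first.
    by rewrite rR // mulr0.
  have uD' : uniq D := map_uniq uD.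
  rewrite (bigD1_seq z) //= rD // eqxx big_seq_cond big1 ?addr0 => [<-|y /andP[yD yz]].
    by rewrite -lD // (covec_vr j vS zS).
  rewrite rD //; case: eqP => [yz2|_]; last by rewrite mulr0.
  by case/eqP: yz; exact: (uniq_map_inj uD).
have := dual_basis_sumE j j vS; rewrite eqxx big_cat /= big_map.
rewrite [X in X + _]big1_seq ?add0r => [|z /= zD]; last by rewrite clD // mul0r.
rewrite [X in X = _]big1_seq => [|x /= xR]; last by rewrite R0 // mulr0.
by move=> /esym/eqP; rewrite (negPf (vtx_neq0 _ _)).
Qed.

(** A nonzero constant entry of column j in a row labelled v is a scalar multiple
    of v, and v is the label of the column; so it can be scaled to v and used to
    clear the column in all the other rows. *)
Lemma gauss_reach m D R : (n.+1 <= size D + m)%N ->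
  dual_basis (map fst D ++ R) -> (forall x, x \in map fst D ++ R -> const_row x) ->
  gauss_state D R -> reach (map fst D ++ R) id_state.
Proof.
elim: m D R => [|m IHm] D R Dm vS cS gS; have [uD lD rD rR] := gS.
  apply: gauss_done => // j; apply: contraT => jD.
  have /card_uniqP : uniq (j :: map snd D) by rewrite /= jD.
  have := max_card (mem (j :: map snd D)); rewrite card_ord => + eq.
  by rewrite eq /= size_map leqNgt ltnS; rewrite addn0 in Dm; rewrite Dm.
have [allD|] := pselect (forall j, j \in map snd D); first exact: gauss_done.
move=> /existsNP[j /negP jD]; have [x xR xj] := gauss_pivot vS gS jD.
have xS : x \in map fst D ++ R by rewrite mem_cat xR orbT.
have [c xjE cE] : exists2 c, vec x 0 j = c *: vtx (label x) & (label x != tnth t j ->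
    c = 0).
  apply: homog0_corner (vec_entry j vS xS).
  by have [h hP] := deg_lt_split (cS x xS j); rewrite /= => /subr0_eq->.
have c0 : c != 0 by apply: contraNneq xj => c0; rewrite xjE c0 scale0r.
have lx : label x = tnth t j by apply/eqP; apply: contraT => /cE/eqP;
    rewrite (negPf c0).
pose x1 : item := (label x, (c^-1 *: vtx (label x)) *: vec x,
    covec x *m (c^-1^-1 *: vtx (label x))%:M).
have x1E k : vec x1 0 k = c^-1 *: vec x 0 k.
  by rewrite mxE -lpa_scalerAl (vec_vl k vS xS).
have x1j : vec x1 0 j = vtx (tnth t j) by rewrite x1E xjE scalerA mulVf // scale1r lx.
pose R' := rem x R.
have pS : perm_eq (map fst D ++ R) (x :: map fst D ++ R').
  rewrite -cat1s perm_sym perm_catCA perm_cat2l /=.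
  by rewrite perm_sym; apply: perm_to_rem.
apply: reach_trans (reach_perm f pS) _.
have ci0 : c^-1 != 0 by rewrite invr_eq0.
apply: reach_trans (reach_scale f ci0) _; rewrite -/x1.
pose xi (y : item) : L := vtx (label y) * - vec y 0 j * vtx (tnth t j).
pose upd (y : item) : item := (label y, vec y + xi y *: vec x1, covec y).
have xiP y : vtx (label y) * xi y * vtx (label x1) = xi y.
  by rewrite /xi -[label x1]/(label x) lx !mulrA lpa_vertexK -!mulrA lpa_vertexK.
have [d] := reach_clear f t (it := id) (map fst D ++ R') [::] xiP.
rewrite !cats0 map_id -/upd; pose x2 : item := (label x1, vec x1, d);
    rewrite -/x2 => rc.
apply: (reach_trans rc).
have memS y : y \in map fst D ++ R' -> y \in map fst D ++ R.
  by rewrite !mem_cat => /orP[->//|/mem_rem->]; rewrite orbT.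
have xiE y : y \in map fst D ++ R' -> xi y = - vec y 0 j.
  by move=> /memS yS; rewrite /xi mulrN mulNr (vec_entry j vS yS).
have updE y k : y \in map fst D ++ R' ->
    vec (upd y) 0 k = vec y 0 k - vec y 0 j * vec x1 0 k.
  move=> yS; have -> : vec (upd y) = vec y + xi y *: vec x1 by [].
  by rewrite [LHS]mxE [X in _ + X]mxE xiE // mulNr.
have updj y : y \in map fst D ++ R' -> vec (upd y) 0 j = 0.
  by move=> yS; rewrite updE // x1j (vec_mulIt j vS (memS _ yS)) subrr.
have updD y k : y \in map fst D ++ R' -> k \in map snd D -> vec (upd y) 0 k = vec y 0 k.
  by move=> yS kD; rewrite updE // x1E (rR x) // scaler0 mulr0 subr0.
have vS1 : dual_basis (x1 :: map fst D ++ R').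
  exact: reach_valid (reach_valid vS (reach_perm f pS)) (reach_scale f ci0).
have vS2 := reach_valid vS1 rc.
pose D' := (x2, j) :: [seq (upd z.1, z.2) | z <- D].
have SE : x2 :: map upd (map fst D ++ R') = map fst D' ++ map upd R'.
  by rewrite /= map_cat -!map_comp.
have sE : map snd D' = j :: map snd D by rewrite /= -map_comp.
move: vS2; rewrite SE => vS2.
apply: IHm => //.
- by rewrite /= size_map addSnnS.
- move=> y; rewrite -SE inE => /predU1P[->|/mapP[z zS ->]] k.
    by rewrite [vec _ _ _]x1E; apply/deg_ltZ/cS.
  rewrite updE //; apply: deg_ltB; first exact/cS/memS.
  apply: (@deg_ltM _ _ 0 1); first exact/cS/memS.
  by rewrite x1E; apply/deg_ltZ/cS.
split; rewrite ?sE.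
- by rewrite /= jD.
- by move=> z; rewrite inE => /predU1P[->|/mapP[y yD ->]]; [exact: lx|exact: (lD y yD)].
- move=> z k; rewrite !inE => /predU1P[->|/mapP[y yD ->]] /=.
    case/predU1P=> [->|kD]; first by rewrite eqxx.
    rewrite [vec _ _ _]x1E rR // scaler0; case: eqP => // jk; by rewrite jk kD in jD.
  have yS : y.1 \in map fst D ++ R' by rewrite mem_cat map_f.
  case/predU1P=> [->|kD]; last by rewrite updD // rD.
  rewrite updj //; case: eqP => // yj; by rewrite -yj map_f in jD.
- move=> _ k /mapP[y yR ->].
  have yS : y \in map fst D ++ R' by rewrite mem_cat yR orbT.
  rewrite inE => /predU1P[->|kD]; first exact: updj.
  by rewrite updD // rR // (mem_rem yR).
Qed.

Lemma gauss_jordan S : dual_basis S -> (forall x, x \in S -> const_row x) ->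
    reach S id_state.
Proof.
by move=> vS cS; apply: (@gauss_reach n.+1 [::] S).
Qed.

End Gauss.

(** * The weak algorithm *)

Section WeakAlgorithm.
Variables (K : fieldType) (E : digraph) (f : vertex E -> seq (edge E)).
Local Notation L := (lpa K E).
Local Notation V := (vertex E).
Local Notation vtx := (@lpa_vertex K E).
Local Notation gho := (@lpa_ghost K E).
Local Notation deg_lt := (@deg_lt K E).
Local Notation homog := (@homog K E).
Local Notation pathpol := (@pathpol K E).
Variables (n : nat) (t : n.+1.-tuple V).
Local Notation item := (item K E n).
Local Notation dual_basis := (@dual_basis K E n t).

Lemma sum_vtx (c : V -> K) v : (\sum_w c w *: vtx w) * vtx v = c v *: vtx v.
Proof.
rewrite mulr_suml (bigD1 v) //= -lpa_scalerAl lpa_vertexK big1 ?addr0 // => w wv.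
by rewrite -lpa_scalerAl lpa_vertexM (negPf wv) scaler0.
Qed.

Lemma homog_vtxr d x v : homog d x -> homog d (x * vtx v).
Proof. by move=> xH; rewrite -[d]addn0; apply: homogM xH (homog_vtx _ _). Qed.

Lemma deg_lt_vtxr d x v : deg_lt d x -> deg_lt d (x * vtx v).
Proof.
case: d => [->|d xP]; first by rewrite mul0r.
by rewrite -addn1; apply: deg_ltM xP (deg_lt_vtx _ _ _).
Qed.

Lemma deg_ltM' d d' x y : deg_lt d x -> deg_lt d'.+1 y -> deg_lt (d + d') (x * y).
Proof.
case: d => [|d] xP yP; first by rewrite xP mul0r; exact: deg_lt0.
by rewrite addSnnS; apply: deg_ltM.
Qed.

(** The weak algorithm for homogeneous vectors: in a left dependence relation of
    total degree D, some vector g_i0 is a combination of vectors of at most its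
    own degree.  If a coefficient of degree 0 occurs, divide by it.  Otherwise all
    coefficients are combinations of paths of positive length,
        and a suitable e^* strips the
    first edge from all of them, which lowers D. *)
Lemma homogeneous_dependence (I : finType) m (v : I -> V) (d : I -> nat)
    (g : I -> 'rV[L]_m) (h : I -> L) D :
  (forall i, h i * vtx (v i) = h i) ->
  (forall i, (d i <= D)%N -> homog (D - d i) (h i)) ->
  (forall i, (D < d i)%N -> h i = 0) ->
  \sum_i h i *: g i = 0 -> (exists i, h i != 0) ->
  exists i0 (x : I -> L), [/\ x i0 = vtx (v i0),
    forall i, vtx (v i0) * x i * vtx (v i) = x i,
    forall i, (d i <= d i0)%N -> homog (d i0 - d i) (x i),
    forall i, (d i0 < d i)%N -> x i = 0 & \sum_i x i *: g i = 0].
Proof.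
have top D' h' : (forall i, h' i * vtx (v i) = h' i) ->
    (forall i, (d i <= D')%N -> homog (D' - d i) (h' i)) ->
    (forall i, (D' < d i)%N -> h' i = 0) -> \sum_i h' i *: g i = 0 ->
    (exists i, h' i != 0 /\ d i = D') -> exists i0 (x : I -> L), [/\ x i0 = vtx (v i0),
    forall i, vtx (v i0) * x i * vtx (v i) = x i,
    forall i, (d i <= d i0)%N -> homog (d i0 - d i) (x i),
    forall i, (d i0 < d i)%N -> x i = 0 & \sum_i x i *: g i = 0].
  move=> hv hH h0 hg [i [hi dE]]; move: (hH i);
      rewrite dE subnn leqnn => /(_ isT)[c cE].
  have {}cE : h' i = c (v i) *: vtx (v i) by rewrite -hv cE sum_vtx.
  have c0 : c (v i) != 0 by apply: contraNneq hi => ci; rewrite cE ci scale0r.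
  exists i, (fun k => (c (v i))^-1 *: (vtx (v i) * h' k)); split.
  - by rewrite cE -lpa_scalerAr lpa_vertexK scalerA mulVf // scale1r.
  - move=> k; rewrite -lpa_scalerAr -lpa_scalerAl; congr (_ *: _).
    by rewrite mulrA lpa_vertexK -mulrA hv.
  - by move=> k; rewrite dE => dk; apply/homogZ/homog_vtxl/hH.
  - by move=> k; rewrite dE => dk; rewrite h0 // mulr0 scaler0.
  - transitivity (((c (v i))^-1 *: vtx (v i)) *: \sum_k h' k *: g k);
      last by rewrite hg scaler0.
    by rewrite scaler_sumr; apply: eq_bigr => k _; rewrite scalerA -lpa_scalerAl.
elim: D h => [|D IHD] h hv hH h0 hg [i hi].
  apply: (top 0%N h) => //; exists i; split=> //; apply/eqP; rewrite -leqn0 leqNgt.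
  by apply: contraNN hi => /h0 ->.
have [[k [hk dk]]|noTop] := pselect (exists k, h k != 0 /\ d k = D.+1).
  by apply: (top D.+1 h) => //; exists k.
have dlt k : h k != 0 -> (d k <= D)%N.
  move=> hk; rewrite leqNgt; apply/negP; rewrite leq_eqVlt => /orP[/eqP dk|lt].
    by apply: noTop; exists k.
  by rewrite h0 ?eqxx in hk.
have hH' k : (d k <= D)%N -> homog (D - d k).+1 (h k).
  by move=> dk; rewrite -subSn //; apply: hH; apply: leqW.
have di := dlt i hi.
have [e he] : exists e, gho e * h i != 0.
  apply: contrapT => no; case/eqP: hi; apply: (homog_ghost_eq0 (hH' i di)) => e.
  by apply: contrapT => /eqP he; apply: no; exists e.
apply: (IHD (fun k => gho e * h k)).
- by move=> k; rewrite -mulrA hv.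
- by move=> k dk; apply/homog_ghost/hH'.
- move=> k dk; have [->|/dlt] := eqVneq (h k) 0; first by rewrite mulr0.
  by rewrite leqNgt dk.
- transitivity (gho e *: \sum_k h k *: g k); last by rewrite hg scaler0.
  by rewrite scaler_sumr; apply: eq_bigr => k _; rewrite scalerA.
- by exists i.
Qed.

(** Row j of the identity matrix is the sum of the y_i a_i with y_i the j-th entry
    of the dual column b_i.  If a row with positive degree occurs in it, the parts
    of top degree have to cancel, since the identity is constant; so the leading
    forms of the rows are dependent, and the dependence gives a combination that
    lowers the degree of one of the rows. *)
Lemma weak_algorithm (I : finType) (s : I -> item) (d : I -> nat) :
  dual_basis (map s (enum I)) ->
  (forall i j, deg_lt (d i).+1 (vec (s i) 0 j)) ->
  (forall i j, pathpol (covec (s i) j 0)) ->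
  (exists i, (0 < d i)%N) ->
  exists i0 (x : I -> L), [/\ x i0 = vtx (label (s i0)),
    forall i, vtx (label (s i0)) * x i * vtx (label (s i)) = x i,
    forall i, pathpol (x i) &
    forall j, deg_lt (d i0) ((\sum_i x i *: vec (s i)) 0 j)].
Proof.
move=> vS rP cP [i1 di1].
have sS i : s i \in map s (enum I) by rewrite map_f ?mem_enum.
have [j yj] : exists j, covec (s i1) j 0 != 0.
  apply: contrapT => no; have c0 : covec (s i1) = 0.
    apply/matrixP=> j k; rewrite ord1 mxE; apply: contrapT => /eqP cj.
    by apply: no; exists j.
  have [_ _ /matrixP/(_ 0 0)] := dual_basis_wf_item vS (sS i1).
  rewrite c0 mulmx0 !mxE eqxx mulr1n => /esym/eqP.
  by rewrite (negPf (vtx_neq0 _ _)).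
pose y i := covec (s i) j 0.
have yv i : y i * vtx (label (s i)) = y i := covec_vr j vS (sS i).
pose bound D := `[< forall i, deg_lt (D - d i) (y i) >].
have exb : exists D, bound D.
  have [D DP] : exists D, forall i, deg_lt (D - d i) (y i).
    apply: bigmaxP => [i m m' mm'|i]; first by apply: deg_lt_mono; apply: leq_sub2r.
    by have [k kP] := cP i j; exists (k + d i)%N; rewrite addnK.
  by exists D; apply/asboolP.
(* D is the total degree: the largest value of (degree of y_i) + d_i. *)
have [[|D] /asboolP bD minD] := ex_minnP exb.
  by case/eqP: yj; apply: (bD i1).
have D0 : (0 < D)%N.
  rewrite lt0n; apply/eqP => D0; case/eqP: yj.
  by have := bD i1; rewrite D0 (eqP (_ : 1 - d i1 == 0)%N).
have /choice[h hP] : forall i, exists h, [/\ h * vtx (label (s i)) = h,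
    (d i <= D)%N -> homog (D - d i) h, (D < d i)%N ->
        h = 0 & deg_lt (D - d i) (y i - h)].
  move=> i; have := bD i; case: (leqP (d i) D) => di.
    rewrite subSn // => /deg_lt_split[h hH hP].
    exists (h * vtx (label (s i))); split=> // [|_|].
    - by rewrite -mulrA lpa_vertexK.
    - exact: homog_vtxr.
    - by rewrite -yv -mulrBl; apply: deg_lt_vtxr.
  move: (di); rewrite -subn_eq0 => /eqP -> y0; exists 0; split=> //.
    by rewrite mul0r.
  by rewrite subr0 y0; apply: deg_lt0.
have /choice[g gP] : forall i, exists g : 'rV[L]_n.+1,
    forall k, homog (d i) (g 0 k) /\ deg_lt (d i) (vec (s i) 0 k - g 0 k).
  move=> i; have /choice[g gP] : forall k, exists g, homog (d i) g /\
      deg_lt (d i) (vec (s i) 0 k - g).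
    by move=> k; have [g ? ?] := deg_lt_split (rP i k); exists g.
  by exists (\row_k g k) => k; rewrite mxE.
have hg0 : \sum_i h i *: g i = 0.
  apply/rowP=> k; rewrite summxE [RHS]mxE; apply: (@homog_deg_lt_eq0 _ _ D).
    apply: homog_sum => i _; rewrite mxE; have [_ hH h0 _] := hP i.
    have [dD|/h0 ->] := leqP (d i) D; last by rewrite mul0r; apply: homog0.
    by rewrite -(subnK dD); apply: homogM; [exact: hH|exact: (gP i k).1].
  have -> : \sum_i (h i *: g i) 0 k = \sum_i y i * vec (s i) 0 k -
     \sum_i ((y i - h i) * vec (s i) 0 k + h i * (vec (s i) 0 k - g i 0 k)).
    rewrite -sumrB; apply: eq_bigr => i _; rewrite mxE mulrBl mulrBr.
    by rewrite addrA subrK opprB addrC subrK.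
  apply: deg_ltB.
    have := dual_basis_sumE j k vS; rewrite big_map big_enum /= => ->.
    case: eqP => _; last exact: deg_lt0.
    exact: deg_lt_mono D0 (deg_lt_vtx _ _ _).
  apply: deg_lt_sum => i _; have [_ hH h0 yh] := hP i; have [gH rg] := gP i k.
  have [dD|Dd] := leqP (d i) D; last first.
    move: (ltnW Dd) yh; rewrite -subn_eq0 => /eqP->; rewrite h0 // subr0 => ->.
    by rewrite !mul0r addr0; apply: deg_lt0.
  apply: deg_ltD; first by have := deg_ltM' yh (rP i k); rewrite subnK.
  by have := deg_ltM (homog_deg_lt (hH dD)) rg; rewrite subnK.
have hne : exists i, h i != 0.
  apply: contrapT => no; have := minD D; rewrite ltnn => /(_ _)/negP[] //.
  apply/asboolP=> i; have [_ _ _] := hP i.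
  have -> : h i = 0 by apply: contrapT => /eqP hi; apply: no; exists i.
  by rewrite subr0.
have [i0 [x [x0 xv xH xz xg]]] :=
    @homogeneous_dependence _ _ (fun i => label (s i)) d g h D
  (fun i => let: And4 a _ _ _ := hP i in a) (fun i => let: And4 _ a _ _ := hP i in a)
  (fun i => let: And4 _ _ a _ := hP i in a) hg0 hne.
exists i0, x; split=> // [i|k].
  have [di|/xz->] := leqP (d i) (d i0); last exact: pathpol0.
  by eexists; apply: homog_deg_lt (xH i di).
have -> : (\sum_i x i *: vec (s i)) 0 k = \sum_i x i * (vec (s i) 0 k - g i 0 k).
  move/rowP/(_ k): xg; rewrite !summxE [X in _ = X]mxE => xg.
  transitivity (\sum_i (x i *: vec (s i)) 0 k - \sum_i (x i *: g i) 0 k).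
    by rewrite xg subr0.
  rewrite -sumrB; apply: eq_bigr => i _.
  by rewrite !mxE mulrBr.
apply: deg_lt_sum => i _; have [di|/xz->] := leqP (d i) (d i0);
    last by rewrite mul0r; apply: deg_lt0.
by rewrite -(subnK di); apply: deg_ltM (homog_deg_lt (xH i di)) (gP i k).2.
Qed.

End WeakAlgorithm.

(** * Rows in the path algebra *)

Section Reduction.
Variables (K : fieldType) (E : digraph) (f : vertex E -> seq (edge E)).
Hypothesis hf : out_enumeration f.
Local Notation L := (lpa K E).
Local Notation V := (vertex E).
Local Notation vtx := (@lpa_vertex K E).
Local Notation edg := (@lpa_edge K E).
Local Notation deg_lt := (@deg_lt K E).
Local Notation pathpol := (@pathpol K E).
Variables (n : nat) (t : n.+1.-tuple V).
Local Notation item := (item K E n).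
Local Notation dual_basis := (@dual_basis K E n t).
Local Notation reach := (@reach K E f n t).
Local Notation id_state := (id_state K t).

(** Lists carry annotations (degrees or levels) in the measures below, while the
    pivoting lemmas speak of indexed families. *)
Definition family (A : Type) (Z : seq (item * A)) (i : 'I_(size Z)) : item :=
  (tnth (in_tuple Z) i).1.

Lemma map_family (A : Type) (Z : seq (item * A)) :
  map (family (Z := Z)) (enum 'I_(size Z)) = map fst Z.
Proof.
rewrite -[RHS]/(map fst (tval (in_tuple Z))) -[in RHS](map_tnth_enum (in_tuple Z)).
by rewrite -map_comp.
Qed.

Lemma sum_family (A : Type) (Z : seq (item * A)) (w : A -> nat) i0 :
  (\sum_(z <- Z) w z.2 = w (tnth (in_tuple Z) i0).2 +
     \sum_(i <- rem i0 (enum 'I_(size Z))) w (tnth (in_tuple Z) i).2)%N.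
Proof.
rewrite (big_tuple _ _ (in_tuple Z)) -big_enum /=.
by rewrite (perm_big _ (perm_to_rem (mem_enum 'I_(size Z) i0))) big_cons.
Qed.

Lemma covec_sub_entry (x y : item) (xi : L) j :
  (covec y - covec x *m xi%:M) j 0 = covec y j 0 - covec x j 0 * xi.
Proof. by rewrite !mxE big_ord1 mxE eqxx mulr1n. Qed.

Lemma covec_mul_entry (x : item) (xi : L) j : (covec x *m xi%:M) j 0 = covec x j 0 * xi.
Proof. by rewrite mxE big_ord1 mxE eqxx mulr1n. Qed.

(** Reduction steps of the weak algorithm lower the sum of the degrees, until the
    rows are constant. *)
Lemma reach_of_path_dual_basis D (Z : seq (item * nat)) :
  (\sum_(z <- Z) z.2 <= D)%N -> dual_basis (map fst Z) ->
  (forall z, z \in Z -> forall j, deg_lt z.2.+1 (vec z.1 0 j)) ->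
  (forall z, z \in Z -> forall j, pathpol (covec z.1 j 0)) ->
  reach (map fst Z) id_state.
Proof.
elim: D Z => [|D IHD] Z sZ vZ rP cP; pose s := family (Z := Z);
  pose d i := (tnth (in_tuple Z) i).2.
  apply: gauss_jordan => // _ /mapP[z zZ ->] j; have := rP z zZ j.
  suff -> : z.2 = 0%N by [].
  apply/eqP; rewrite -leqn0; apply: leq_trans sZ.
  by rewrite (big_rem z) //= leq_addr.
have [[i1 di1]|d0] := pselect (exists i, (0 < d i)%N); last first.
  apply: gauss_jordan => // _ /mapP[z zZ ->] j; have := rP z zZ j.
  suff -> : z.2 = 0%N by [].
  have /(tnthP (in_tuple Z))[i zi] := zZ.
  apply/eqP; rewrite -leqn0 leqNgt; apply/negP => z0; apply: d0; exists i.
  by rewrite /d -zi.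
have vS : dual_basis (map s (enum 'I_(size Z))) by rewrite map_family.
have [||i0 [x [x0 xv xP xd]]] := weak_algorithm (s := s) (d :=
    d) vS _ _ (ex_intro _ i1 di1).
- by move=> i j; apply: rP; apply: mem_tnth.
- by move=> i j; apply: cP; apply: mem_tnth.
have sS i : s i \in map s (enum 'I_(size Z)) by rewrite map_f ?mem_enum.
have [||y [yl yr yc ry]] := reach_replace f t (s := s) (i0 := i0) (xi :=
    x) (oner_neq0 K) _ xv.
- by rewrite x0 scale1r.
- by move=> i; have [] := dual_basis_wf_item vS (sS i).
have vS' := reach_valid vS ry.
have d0 : (0 < d i0)%N.
  rewrite lt0n; apply/eqP => d0.
  have /eqP[] := dual_basis_vec_neq0 vS' (mem_head _ _).
  by apply/rowP=> j; rewrite yr mxE; have := xd j; rewrite d0.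
pose upd i : item := (label (s i), vec (s i), covec (s i) - covec y *m (x i)%:M).
pose Z' := (y, (d i0).-1) :: [seq (upd i, d i) | i <- rem i0 (enum 'I_(size Z))].
have ZE : map fst Z' = y :: map upd (rem i0 (enum 'I_(size Z))).
  by rewrite /= -map_comp.
have yP j : pathpol (covec y j 0).
  rewrite yc covec_mul_entry; apply: pathpolM; last exact/pathpolZ/pathpol_vtx.
  by apply: cP; apply: mem_tnth.
rewrite map_family in ry; apply: reach_trans ry _; rewrite -/upd -ZE; apply: IHD.
- rewrite -ltnS; apply: leq_trans sZ; have /= -> := sum_family (fun k : nat => k) i0.
  rewrite big_cons big_map /=.
  by rewrite -addSn prednK.
- by rewrite ZE.
- move=> z; rewrite inE => /predU1P[->|/mapP[i _ ->]] j.
    by have := xd j; rewrite -yr -[in X in X -> _](prednK d0).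
  exact: (rP _ (mem_tnth i (in_tuple Z)) j).
- move=> z; rewrite inE => /predU1P[->//|/mapP[i _ ->]] j.
  rewrite [covec _]/(covec (s i) - covec y *m (x i)%:M) covec_sub_entry.
  apply: pathpolD; first by apply: cP; apply: mem_tnth.
  exact/pathpolN/pathpolM.
Qed.

Lemma const_coef_corner v w x : pathpol x -> vtx v * x * vtx w = x -> v != w ->
  const_coef v x = 0.
Proof.
move=> xP xE vw; have vx : vtx v * x = x by rewrite -xE !mulrA lpa_vertexK.
have [y yE yP] := proper_split xP vx.
have xw : x * vtx w = x by rewrite -xE -!mulrA lpa_vertexK.
rewrite -xw {1}yE mulrDl -lpa_scalerAl lpa_vertexM (negPf vw) scaler0 add0r.
by apply/const_coef_proper/properMr; last exact: pathpol_vtx.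
Qed.

(** A graded Nakayama argument.  A right inverse C of the matrix of constant
    terms gives A C = 1 + Y with Y proper, hence the matrix B of dual columns,
    which is the inverse of A, satisfies B = C - B Y.  Each path in Y has positive
    length, so this equation lowers the level of B, and N steps bring B into the
    path algebra. *)
Lemma path_covec_of_const_free m (s : 'I_m -> item) N :
  dual_basis (map s (enum 'I_m)) ->
  (forall i j, pathpol (vec (s i) 0 j)) ->
  row_free (\matrix_(i < m, j < n.+1) const_coef (label (s i)) (vec (s i) 0 j)) ->
  (forall i j, level N (covec (s i) j 0)) ->
  forall i j, pathpol (covec (s i) j 0).
Proof.
move=> vS rP; set A := \matrix_(i, j) _ => /row_freeP[C AC] cN.
have sS i : s i \in map s (enum 'I_m) by rewrite map_f ?mem_enum.
have A0 i j : label (s i) != tnth t j -> A i j = 0.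
  by move=> ij; rewrite mxE; apply: const_coef_corner (vec_entry j vS (sS i)) ij.
(* C need not respect the labels, but its entries between different labels
   meet only zeros of A and can be dropped. *)
pose c (i : 'I_m) (j : 'I_n.+1) : L :=
    (if tnth t j == label (s i) then C j i else 0) *: vtx (label (s i)).
have [y yP yE] : exists2 y : 'I_m -> 'I_m -> L, forall k i, proper (y k i) &
   forall k i, \sum_j vec (s k) 0 j * c i j = (k == i)%:R *: vtx (label (s k)) + y k i.
  pose X k i := \sum_j vec (s k) 0 j * c i j.
  have XP k i : pathpol (X k i).
    by apply: pathpol_sum => j _; apply: pathpolM => //; apply/pathpolZ/pathpol_vtx.
  have vX k i : vtx (label (s k)) * X k i = X k i.
    rewrite mulr_sumr; apply: eq_bigr => j _.
    by rewrite mulrA (vec_vl j vS (sS k)).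
  exists (fun k i => X k i - (k == i)%:R *: vtx (label (s k))) => k i; last first.
    by rewrite addrC subrK.
  have [z zE zP] := proper_split (XP k i) (vX k i).
  suff <- : const_coef (label (s k)) (X k i) = (k == i)%:R by rewrite {1}zE addrC addKr.
  have termE j : const_coef (label (s k)) (vec (s k) 0 j * c i j) =
      if tnth t j == label (s i) then A k j * C j i else 0.
    rewrite -lpa_scalerAr const_coefZ mulrC; case: eqP => tj; last exact: mulr0.
    by rewrite -tj (vec_mulIt j vS (sS k)) [A k j]mxE.
  rewrite const_coef_sum; have [ki|ki] := eqVneq (label (s k)) (label (s i)).
    have <- : (A *m C) k i = (k == i)%:R by rewrite AC mxE.
    rewrite [RHS]mxE; apply: eq_bigr => j _; rewrite termE; case: eqP => // /eqP tj.
    by rewrite A0 ?mul0r // ki eq_sym.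
  have -> : (k == i) = false by apply/eqP => kE; rewrite kE eqxx in ki.
  apply: big1 => j _; rewrite termE; case: eqP => // tj.
  by rewrite A0 ?mul0r // tj.
have clE i j : covec (s i) j 0 = c i j - \sum_k covec (s k) j 0 * y k i.
  apply/eqP; rewrite eq_sym subr_eq; apply/eqP.
  transitivity (\sum_k covec (s k) j 0 * \sum_j' vec (s k) 0 j' * c i j').
    under eq_bigr do rewrite mulr_sumr.
    rewrite exchange_big /= (bigD1 j) //= [X in _ + X]big1 ?addr0 => [|j' jj'].
      under eq_bigr do rewrite mulrA.
      have := dual_basis_sumE j j vS; rewrite big_map big_enum /= eqxx -mulr_suml => ->.
      rewrite /c -lpa_scalerAr lpa_vertexM; case: eqP => [->|_] //.
      by rewrite !scale0r.
    under eq_bigr do rewrite mulrA.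
    have := dual_basis_sumE j j' vS;
        rewrite big_map big_enum /= eq_sym (negPf jj') -mulr_suml => ->.
    by rewrite mul0r.
  under eq_bigr do rewrite yE mulrDr.
  rewrite big_split /= (bigD1 i) //= big1 => [|k ki]; last first.
    by rewrite (negPf ki) scale0r mulr0.
  by rewrite eqxx scale1r (covec_vr j vS (sS i)) addr0.
elim: N cN => [|N IHN] cN //; apply: IHN => i j; rewrite clE.
apply: levelD; first by apply: (@level_mono _ _ 0) => //; apply/pathpolZ/pathpol_vtx.
rewrite -scaleN1r; apply/levelZ/level_sum => k _.
have [z -> zP] := yP k i; rewrite mulr_sumr; apply: level_sum => e _.
by rewrite mulrA; apply: levelMr => //; apply: (cN k j).2.
Qed.

(** If the constant terms of the rows are independent over K, the dual columns lie
    in the path algebra and the weak algorithm applies.  Otherwise some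
    combination of rows with the same label has no constant term.  Such a
    combination replaces one of the rows, and the new row is expanded, which
    strips its first edges and lowers the level of its dual column by one.  Among
    the rows of the combination, one of minimal level is replaced: then the other
    levels do not grow.  A row of level N weighs M ^ N, where M exceeds the number
    of rows that an expansion creates, so the total weight drops. *)
Lemma reach_of_path_vecs W (Z : seq (item * nat)) :
  (\sum_(z <- Z) #|edge E|.+1 ^ z.2 <= W)%N -> dual_basis (map fst Z) ->
  (forall z, z \in Z -> forall j, pathpol (vec z.1 0 j)) ->
  (forall z, z \in Z -> forall j, level z.2 (covec z.1 j 0)) ->
  reach (map fst Z) id_state.
Proof.
elim: W Z => [|W IHW] Z sZ vZ rP cP.
  have := dual_basis_size vZ; rewrite size_map; case: Z sZ {vZ rP cP} => // z Z.
  by rewrite big_cons leqn0 addn_eq0 expn_eq0.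
pose s := family (Z := Z); pose d i := (tnth (in_tuple Z) i).2.
have vS : dual_basis (map s (enum 'I_(size Z))) by rewrite map_family.
have sS i : s i \in map s (enum 'I_(size Z)) by rewrite map_f ?mem_enum.
have rPs i j : pathpol (vec (s i) 0 j) by apply: rP; apply: mem_tnth.
have cPs i j : level (d i) (covec (s i) j 0) by apply: cP; apply: mem_tnth.
pose A := \matrix_(i < size Z, j < n.+1) const_coef (label (s i)) (vec (s i) 0 j).
have A0 i j : label (s i) != tnth t j -> A i j = 0.
  by move=> ij; rewrite mxE; apply: const_coef_corner (vec_entry j vS (sS i)) ij.
have [Afree|] := boolP (row_free A).
  have colP := path_covec_of_const_free vS rPs Afree
    (fun i j => level_mono (leq_bigmax i) (cPs i j)).
  have /choice[d' d'P] : forall i, exists d, forall j, deg_lt d.+1 (vec (s i) 0 j).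
    move=> i; apply: bigmaxP => [j m m' mm'|j]; first by apply: deg_lt_mono.
    by have [k kP] := rPs i j; exists k; apply: deg_lt_mono kP.
  pose Z' := [seq (s i, d' i) | i <- enum 'I_(size Z)].
  have ZE : map fst Z' = map fst Z by rewrite -map_comp -[RHS]map_family.
  rewrite -ZE; apply: (reach_of_path_dual_basis (leqnn _)); first by rewrite ZE.
    by move=> _ /mapP[i _ ->]; apply: d'P.
  by move=> _ /mapP[i _ ->]; apply: colP.
rewrite -kermx_eq0 => /rowV0Pn[u /sub_kermxP uA /rV0Pn[i1 ui1]].
pose P i := (u 0 i != 0) && (label (s i) == label (s i1)).
have Pi1 : P i1 by rewrite /P ui1 eqxx.
case: (arg_minnP d Pi1) => i0 /andP[ui0 /eqP li0] min0.
pose v := label (s i0).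
pose xi i : L := (if label (s i) == v then u 0 i else 0) *: vtx v.
have [|i||y [yl yr yc ry]] := reach_replace f t (s := s) (i0 := i0) (xi := xi) ui0.
- by rewrite /xi eqxx.
- rewrite -/v /xi -lpa_scalerAr lpa_vertexK -lpa_scalerAl lpa_vertexM.
  by rewrite [v == _]eq_sym; case: (label (s i) == v); rewrite ?scale0r.
- by move=> i; have [] := dual_basis_wf_item vS (sS i).
have vS' := reach_valid vS ry.
have yS : y \in y :: [seq (label (s i), vec (s i), covec (s i) - covec y *m (xi i)%:M)
    | i <- rem i0 (enum 'I_(size Z))] by apply: mem_head.
have yrE j : vec y 0 j = \sum_i xi i * vec (s i) 0 j.
  by rewrite yr summxE; apply: eq_bigr => i _; rewrite mxE.
have yproper j : proper (vec y 0 j).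
  have yP : pathpol (vec y 0 j).
    by rewrite yrE; apply: pathpol_sum => i _; apply: pathpolM => //;
        apply/pathpolZ/pathpol_vtx.
  have [z zE zP] := proper_split yP (vec_vl j vS' yS).
  suff c0 : const_coef (label y) (vec y 0 j) = 0 by rewrite zE c0 scale0r add0r.
  have termE i : const_coef (label y) (xi i * vec (s i) 0 j) =
      if label (s i) == v then u 0 i * A i j else 0.
    rewrite yl /xi -/v; case: eqP => [<-|_]; last by rewrite scale0r mul0r const_coef0.
    by rewrite -lpa_scalerAl (vec_vl j vS (sS i)) const_coefZ [A i j]mxE.
  rewrite yrE const_coef_sum; have [tj|tj] := eqVneq (tnth t j) v.
    transitivity ((u *m A) 0 j); last by rewrite uA mxE.
    rewrite [RHS]mxE; apply: eq_bigr => i _; rewrite termE; case: eqP => // /eqP iv.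
    by rewrite A0 ?mulr0 // tj.
  apply: big1 => i _; rewrite termE; case: eqP => // iv.
  by rewrite A0 ?mulr0 // iv eq_sym.
have y_neq0 := dual_basis_vec_neq0 vS' yS.
(* At a sink, an element without constant term is zero. *)
have yreg : regular (label y).
  apply: contraT => ysink; case/eqP: y_neq0; apply/rowP=> j; rewrite [RHS]mxE.
  have [z zE _] := yproper j; rewrite -(vec_vl j vS' yS) zE vtx_sum_edge big1 // => e _.
  case: eqP => [ev|_]; last exact: mulr0.
  by case/negP: ysink; apply/card_gt0P; exists e; rewrite inE ev.
(* Otherwise the label, as the product of the row and the dual column of y, would have no
   constant term. *)
have d_gt0 : (0 < d i0)%N.
  rewrite lt0n; apply/eqP => d0.
  have [_ _ /matrixP/(_ 0 0)] := dual_basis_wf_item vS' yS;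
      rewrite !mxE eqxx mulr1n => vE.
  have : const_coef (label y) (vtx (label y)) = 0.
    rewrite -vE; apply: const_coef_proper.
    elim/big_ind: _ => [||j _]; [exact: proper0|exact: properD|].
    apply: properMr (yproper j) _; rewrite yc covec_mul_entry.
    apply: pathpolM; last exact/pathpolZ/pathpol_vtx.
    by have := cPs i0 j; rewrite d0.
  by rewrite const_coef_vtx eqxx => /eqP; rewrite oner_eq0.
pose upd i : item := (label (s i), vec (s i), covec (s i) - covec y *m (xi i)%:M).
pose Z' := [seq (x, (d i0).-1) | x <- expand f y] ++
           [seq (upd i, d i) | i <- rem i0 (enum 'I_(size Z))].
have ZE : map fst Z' = expand f y ++ map upd (rem i0 (enum 'I_(size Z))).
  by rewrite map_cat -!map_comp; congr (_ ++ _); apply: map_id.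
have ry' := reach_expand hf (t := t) (S := map upd (rem i0 (enum 'I_(size Z)))) yreg.
have vZ' := reach_valid vS' ry'.
rewrite map_family in ry; apply: reach_trans ry _; apply: reach_trans ry' _.
have ycl j : level (d i0) (covec y j 0).
  by rewrite yc covec_mul_entry; apply: levelMr => //; apply/pathpolZ/pathpol_vtx.
rewrite -ZE; apply: IHW.
- rewrite -ltnS; apply: leq_trans sZ.
  have /= -> := sum_family (fun k : nat => (#|edge E|.+1 ^ k)%N) i0.
  rewrite big_cat !big_map /= -addSn leq_add2r -/(d i0).
  rewrite big_const_seq count_predT iter_addn_0 mulnC.
  rewrite -[X in (_ < _ ^ X)%N](prednK d_gt0) expnS ltn_pmul2r ?expn_gt0 //.
  by rewrite ltnS (perm_size (hf _)) -cardE max_card.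
- by rewrite ZE.
- move=> z; rewrite mem_cat => /orP[/mapP[_ /mapP[e _ ->] ->]|/mapP[i _ ->]] j;
    last exact: rPs.
  by rewrite mxE; apply: ghost_proper.
- move=> z; rewrite mem_cat => /orP[/mapP[_ /mapP[e _ ->] ->]|/mapP[i _ ->]] j.
    rewrite -[X in level _ X]/((covec y *m (edg e)%:M) j 0) covec_mul_entry.
    by have := ycl j; rewrite -(prednK d_gt0) => -[_ /(_ e)].
  rewrite [covec _]/(covec (s i) - covec y *m (xi i)%:M) covec_sub_entry.
  apply: levelD; first exact: cPs.
  rewrite -scaleN1r; apply: levelZ; rewrite /xi; case: eqP => iv; last first.
    by rewrite scale0r mulr0; apply: level0.
  have [->|ui] := eqVneq (u 0 i) 0; first by rewrite scale0r mulr0; apply: level0.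
  apply: levelMr; last exact/pathpolZ/pathpol_vtx.
  by apply: level_mono (ycl j); apply: min0; rewrite /P ui iv /v li0 eqxx.
Qed.

End Reduction.

(** * Arbitrary invertible matrices *)

Section Assembly.
Variables (K : fieldType) (E : digraph) (f : vertex E -> seq (edge E)).
Hypothesis hf : out_enumeration f.
Local Notation L := (lpa K E).
Local Notation V := (vertex E).
Local Notation vtx := (@lpa_vertex K E).
Local Notation edg := (@lpa_edge K E).
Local Notation gho := (@lpa_ghost K E).
Local Notation pathpol := (@pathpol K E).
Local Notation gen := (@gen K E f).

Section ExpandAll.
Variables (n : nat) (t : n.+1.-tuple V).
Local Notation item := (item K E n).
Local Notation dual_basis := (@dual_basis K E n t).
Local Notation reach := (@reach K E f n t).

Definition expand_regular (x : item) : seq item :=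
  if regular (label x) then expand f x else [:: x].

Lemma reach_expand_all S : reach S (flatten (map expand_regular S)).
Proof.
suff H T : reach (S ++ T) (flatten (map expand_regular S) ++ T).
  by have := H [::]; rewrite !cats0.
elim: S T => [|x S IHS] T /=; first exact: reach_refl.
have r1 : reach (x :: S ++ T) (expand_regular x ++ (S ++ T)).
  rewrite /expand_regular; case: ifP => xreg; last exact: reach_refl.
  exact: reach_expand.
apply: (reach_trans r1); apply: (reach_trans (S2 := S ++ (expand_regular x ++ T))).
  by apply: reach_perm; rewrite perm_catCA.
by apply: reach_trans (IHS _) _; apply: reach_perm; rewrite -catA perm_catCA.
Qed.

(** The dual column b of an expanded row becomes b e, of smaller level; at a sink
    v, where no expansion is possible, b = b v lies in the path algebra. *)
Lemma reach_path_covecs N S : dual_basis S -> (forall x, x \in S -> forall j,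
    level N (covec x j 0)) ->
  exists2 S', reach S S' & forall x, x \in S' -> forall j, pathpol (covec x j 0).
Proof.
elim: N S => [|N IHN] S vS cS; first by exists S => //; apply: reach_refl.
have r1 := @reach_expand_all S.
have [|S' r2 cS'] := IHN _ (reach_valid vS r1); last first.
  by exists S' => //; apply: reach_trans r1 r2.
move=> y /flatten_mapP[x xS]; rewrite /expand_regular; case: ifP => xreg.
  case/mapP=> e _ -> j.
  rewrite -[X in level _ X]/((covec x *m (edg e)%:M) j 0) covec_mul_entry.
  exact: (cS x xS j).2.
rewrite inE => /eqP-> j; apply: (@level_mono _ _ 0) => //.
by rewrite -(covec_vr j vS xS); apply: (cS x xS j).1; rewrite xreg.
Qed.

End ExpandAll.

Definition state_of k m (s : k.+1.-tuple V) (t : m.-tuple V)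
    (B : 'M[L]_(m, k.+1)) (A : 'M[L]_(k.+1, m)) : m.-tuple (item K E k) :=
  [tuple (tnth t j, row j B, col j A) | j < m].

Lemma dual_basis_state_of k m (s : k.+1.-tuple V) (t : m.-tuple V) A B :
  in_corner vtx s t A -> corner_inverse vtx s t A B -> dual_basis s (state_of s t B A).
Proof.
move=> sA [tB AB BA]; have vK := @lpa_vertexK K E.
have BAE i j : row i B *m col j A = ((if i == j then vtx (tnth t i) else 0))%:M.
  rewrite [LHS]mx11_scalar; congr (_%:M).
  transitivity ((B *m A) i j); first by rewrite !mxE; apply: eq_bigr => l _;
      rewrite !mxE.
  by rewrite BA !mxE; case: eqP => [->|]; rewrite ?mulr1n ?mulr0n.
split.
- move=> x /(tnthP (state_of s t B A))[j ->]; rewrite tnth_map tnth_ord_tuple.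
  split; rewrite /label /vec /covec /=.
  + have /matrixP BE := corner_mul1mx vK tB.
    apply/rowP=> l; have := BE j l; rewrite mul_diag_mx !mxE; exact.
  + have /matrixP AE := corner_mulmx1 vK sA.
    apply/colP=> l; have := AE l j; rewrite mul_mx_diag !mxE big_ord1 !mxE eqxx mulr1n.
    exact.
  + by rewrite BAE eqxx.
- rewrite pairwise_map; have := enum_uniq 'I_m; rewrite uniq_pairwise.
  rewrite val_ord_tuple; apply: sub_pairwise => i j /= ij.
  by rewrite /orth /vec /covec /= !BAE eq_sym [j == i]eq_sym (negPf ij) raddf0 eqxx.
- rewrite -AB big_tuple; apply/matrixP=> i j; rewrite summxE mxE.
  by apply: eq_bigr => l _; rewrite tnth_map tnth_ord_tuple mxE big_ord1 !mxE.
Qed.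

Lemma labels_state_of k m (s : k.+1.-tuple V) (t : m.-tuple V) A B :
  labels (state_of s t B A) = t.
Proof. by apply: eq_from_tnth => i; rewrite !tnth_map tnth_ord_tuple. Qed.

(** The rows of A are the rows of a dual basis, whose gram matrix with the standard
    basis is A. *)
Lemma gen_of_path_entries m n (s : m.+1.-tuple V) (t : n.+1.-tuple V) A B :
  in_corner vtx s t A -> corner_inverse vtx s t A B ->
  (forall i j, pathpol (A i j)) -> gen s t A.
Proof.
move=> sA AB Apol; have [tB AB1 BA1] := AB.
pose Y := state_of t s A B.
have vY : dual_basis t Y by apply: dual_basis_state_of tB _; split.
have /choice[N NP] : forall i, exists N, forall j, level N (B j i).
  move=> i; apply: bigmaxP => [j k k' kk'|j]; first exact: level_mono.
  exact: level_exists.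
pose Z := [seq (tnth Y i, N i) | i <- enum 'I_m.+1].
have ZE : map fst Z = Y.
  by rewrite -map_comp -[RHS](map_tnth_enum Y).
have tnY i : tnth Y i = (tnth s i, row i A, col i B) by rewrite tnth_map tnth_ord_tuple.
have r : reach f t (map fst Z) (id_state K t).
  apply: (reach_of_path_vecs hf (leqnn _)).
  - by rewrite ZE.
  - by move=> _ /mapP[i _ ->] j; rewrite tnY [vec _]/(row i A) mxE.
  - by move=> _ /mapP[i _ ->] j; rewrite tnY [covec _]/(col i B) mxE; apply: NP.
rewrite ZE in r; have [vI gI] := r vY.
pose I := [tuple id_item K t j | j < n.+1].
have := (gen_in_tuple f Y I).2 gI; rewrite labels_state_of.
have -> : labels I = t by apply: eq_from_tnth => i; rewrite !tnth_map tnth_ord_tuple.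
suff -> : gram Y I = A by [].
apply/matrixP=> i j; rewrite mxE tnY tnth_map tnth_ord_tuple.
have /matrixP/(_ i j) <- := corner_mulmx1 (@lpa_vertexK K E) sA.
rewrite [vec _]/(row i A) [covec _]/(delta_mx j 0 *m (vtx (tnth t j))%:M) mulmxA.
rewrite -colE mul_mx_diag !mxE big_ord1 !mxE eqxx mulr1n.
by [].
Qed.

(** The rows of B = A^-1 are expanded until the dual columns, which start as the
    columns of A, lie in the path algebra.  These columns form an invertible
    matrix A' over the path algebra, and the moves show that B A' is generated. *)
Lemma gen_GLmx m n (s : m.+1.-tuple V) (t : n.+1.-tuple V) A :
  GLmx vtx s t A -> gen s t A.
Proof.
move=> [sA [B AB]]; have [tB AB1 BA1] := AB; have vK := @lpa_vertexK K E.
pose X := state_of s t B A.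
have vX : dual_basis s X by apply: dual_basis_state_of.
have tnX i : tnth X i = (tnth t i, row i B, col i A) by rewrite tnth_map tnth_ord_tuple.
have /choice[N NP] : forall j, exists N, forall i, level N (A i j).
  move=> i; apply: bigmaxP => [j k k' kk'|j]; first exact: level_mono.
  exact: level_exists.
have levX x : x \in X -> forall j, level (\max_i N i) (covec x j 0).
  move=> /(tnthP X)[i ->] j; rewrite tnX [covec _]/(col i A) mxE.
  by apply: level_mono (NP i j); apply: leq_bigmax.
have [S rS colS] := reach_path_covecs vX levX.
have [vS gS] := rS vX.
case: S vS gS colS {rS} => [|x S] vS gS colS; first by have := dual_basis_size vS.
pose Y := in_tuple (x :: S); pose t' : (size S).+1.-tuple V := labels Y.
pose A' : 'M[L]_(m.+1, (size S).+1) := \matrix_(i, j) covec (tnth Y j) i 0.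
pose B' : 'M[L]_((size S).+1, m.+1) := \matrix_(i, j) vec (tnth Y i) 0 j.
have gBA : gen t t' (B *m A').
  have := (gen_in_tuple f X Y).2 gS; rewrite labels_state_of.
  suff -> : gram X Y = B *m A' by [].
  apply/matrixP=> i j; rewrite mxE tnX [vec _]/(row i B) !mxE.
  by apply: eq_bigr => l _; rewrite !mxE.
have sA' : in_corner vtx s t' A'.
  move=> i j; exists (A' i j); rewrite tnth_map mxE.
  have yY : tnth Y j \in x :: S by apply: mem_tnth.
  rewrite -mulrA (covec_vr i vS yY).
  have /matrixP/(_ i 0) <- := dual_basis_mem_covec vS yY.
  by rewrite mul_diag_mx !mxE mulrA vK.
have AB' : corner_inverse vtx s t' A' B'.
  split.
  - move=> i j; exists (B' i j); rewrite tnth_map mxE.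
    have yY : tnth Y i \in x :: S by apply: mem_tnth.
    by rewrite (vec_entry j vS yY).
  - rewrite -(dual_basis_sum vS) (big_tuple _ _ Y); apply/matrixP=> i j.
    by rewrite summxE mxE; apply: eq_bigr => l _; rewrite !mxE big_ord1.
  - rewrite -(gram_self (X := Y) vS) //; apply/matrixP=> i j; rewrite !mxE.
    by apply: eq_bigr => l _; rewrite !mxE.
have gA' : gen s t' A'.
  by apply: gen_of_path_entries sA' AB' _ => i j; rewrite mxE; apply: colS;
      apply: mem_tnth.
have gB' : gen t' s B' := gen_inv gA' AB'.
have gB : gen t s B.
  have [_ AB1' _] := AB'.
  have -> : B = (B *m A') *m B' by rewrite -mulmxA AB1' (corner_mulmx1 vK tB).
  exact: gen_mul gBA gB'.
by apply: gen_inv gB _; split.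
Qed.

End Assembly.

Theorem theorem4p13 (K : fieldType) (E : digraph)
    (f : vertex E -> seq (edge E)) (hf : out_enumeration f) :
  @generates (lpa_groupoid K E) (@EFP K E f).
Proof.
split=> [a|a b g].
  exists a; left; exists (gidm a).
  exact/EFPmx_E/Emx_id.
case: a b g => [n t] [m s] [A GA].
have [h hE hS] := gen_subgroupoid (gen_GLmx hf GA).
suff <- : h = exist _ A GA by [].
exact: gl_hom_inj.
Qed.
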